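(* Let $R$ be a Noetherian ring and $s$ a positive integer. (a) If $s \le \dim R$, there exists a sequence $a_1,\ldots,a_s \in R$ that is independent with respect to every monomial order. (b) If $s > \dim R$, every sequence $a_1,\ldots,a_s \in R$ is dependent with respect to every monomial order.
   Context: All rings are commutative with identity; $\dim$ denotes Krull dimension. A monomial order $\prec$ is a strict total order on the monomials in the variables $x_1,x_2,\ldots$ such that $1 \prec f$ for every monomial $f \neq 1$, and $f \prec g$ implies $fh \prec gh$ for all monomials $f,g,h$. For a polynomial $f$ over $R$, $\operatorname{in}_\prec(f)$ denotes the least term (coefficient times monomial) of $f$ with respect to $\prec$ (with $\operatorname{in}_\prec(0)=0$, having coefficient $0$). A sequence $a_1,\ldots,a_s \in R$ is dependent with respect to $\prec$ if there exists $f \in R[x_1,\ldots,x_s]$ with $f(a_1,\ldots,a_s)=0$ such that the coefficient of $\operatorname{in}_\prec(f)$ is invertible in $R$; otherwise it is independent with respect to $\prec$. *)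

(* Defs.v *)
From mathcomp Require Import all_boot all_order all_algebra.
From mathcomp Require Import boolp classical_sets.
From mathcomp Require Import finmap.
From mathcomp Require Import monalg.
(* The notations of constructive_ereal clash with those of monalg. *)
From mathcomp Require Import -(notations) constructive_ereal.

Set Implicit Arguments.
Unset Strict Implicit.
Unset Printing Implicit Defensive.

Import Order.TTheory GRing.Theory Num.Theory.

Local Open Scope classical_set_scope.
Local Open Scope ring_scope.

(* Rings are [comPzRingType]s, so that the zero ring is included. *)

Section KrullDimension.
Context (R : comPzRingType).

Definition is_ideal (I : set R) : Prop :=
  [/\ I 0, forall x y, I x -> I y -> I (x + y) & forall a x, I x -> I (a * x)].

Definition is_prime_ideal (P : set R) : Prop :=
  [/\ is_ideal P, ~ P 1 & forall x y, P (x * y) -> P x \/ P y].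

Definition ideal_span (n : nat) (g : 'I_n -> R) : set R :=
  [set x | exists c : 'I_n -> R, x = \sum_i c i * g i].

Definition noetherian : Prop :=
  forall I : set R, is_ideal I ->
    exists (n : nat) (g : 'I_n -> R), I = ideal_span g.

(* P 0 < P 1 < ... < P n, so the length n counts the strict inclusions;
   the values P i for i > n are irrelevant. *)
Definition prime_chain (n : nat) (P : nat -> set R) : Prop :=
  (forall i, (i <= n)%N -> is_prime_ideal (P i)) /\
  (forall i, (i < n)%N -> P i `<` P i.+1).

(* The supremum of the lengths of chains of prime ideals, taken in the
   integers extended with -oo and +oo: it is -oo for the zero ring and +oo
   when there are arbitrarily long chains. *)
Definition krull_dim : extended int :=
  supremum (@ENInf int) [set EFin n%:Z | n in [set n | exists P, prime_chain n P]].

End KrullDimension.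

Arguments noetherian R : clear implicits.
Arguments krull_dim R : clear implicits.

(* {cmonom nat} is the type of monomials in countably many variables: x_(i+1)
   corresponds to the index i, and [m i] is its exponent in m. *)
Record monomial_order (lt : {cmonom nat} -> {cmonom nat} -> Prop) : Prop :=
  MonomialOrder {
    monomial_order_irr : forall m, ~ lt m m;
    monomial_order_trans : forall m1 m2 m3, lt m1 m2 -> lt m2 m3 -> lt m1 m3;
    monomial_order_total : forall m1 m2, [\/ lt m1 m2, m1 = m2 | lt m2 m1];
    monomial_order_gt1 : forall m : {cmonom nat}, m <> mone -> lt mone m;
    monomial_order_mul : forall m1 m2 m : {cmonom nat}, lt m1 m2 -> lt (mmul m1 m) (mmul m2 m)
  }.

Section Dependence.
Context (R : comPzRingType).
Implicit Types (lt : {cmonom nat} -> {cmonom nat} -> Prop)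
               (f : {malg R[{cmonom nat}]}).

(* R[x_1, ..., x_s] as the subset of R[x_1, x_2, ...] of the polynomials in
   which only the first s variables occur. *)
Definition in_first_vars (s : nat) f : Prop :=
  forall m, m \in msupp f -> forall i, (s <= i)%N -> m i = 0%N.

(* [mmap] of the library requires a nontrivial ring. *)
Definition eval_first_vars (s : nat) (a : 'I_s -> R) f : R :=
  \sum_(m <- msupp f) f@_m * \prod_(i < s) a i ^+ m i.

Definition init_monom lt f : {cmonom nat} :=
  xget mone [set m | m \in msupp f /\
                    forall m', m' \in msupp f -> m' <> m -> lt m m'].

(* For f = 0 the monomial is a default value and the term is 0. *)
Definition init_term lt f : {malg R[{cmonom nat}]} :=
  << f@_(init_monom lt f) *g init_monom lt f >>.

Definition init_coef lt f : R := (init_term lt f)@_(init_monom lt f).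

Definition invertible (c : R) : Prop := exists d : R, c * d = 1.

Definition dependent lt (s : nat) (a : 'I_s -> R) : Prop :=
  exists f, [/\ in_first_vars s f, eval_first_vars a f = 0
              & invertible (init_coef lt f)].

Definition independent lt (s : nat) (a : 'I_s -> R) : Prop :=
  ~ dependent lt a.

End Dependence.

(* Main.v *)
(* Everything local at a prime Q is done inside R, with ideals saturated by the
   complement of Q.

   (a) Choose a_1, ..., a_s such that every prime containing them has height at
   least s, and let Q be a minimal prime over them.  In a relation at the a_i
   whose least coefficient is invertible, the order can be replaced by a positive
   integral weight w.  Modulo a_j^(w_1) - a_1^(w_j), for j > 1, every monomial of
   weight v becomes a_1^v up to taking powers, and the relation forces a_1 to be
   nilpotent there.  Then Q is minimal over s - 1 elements, which contradicts
   Krull's height theorem.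

   (b) If a is independent, the coefficients of the least terms of the relations
   at a generate a proper ideal; let Q be a minimal prime over it.  As Q has
   height less than s, it is minimal over fewer than s parameters y_j, so that
   the length of R/(y_j^N) at Q is O(N^(s-1)).  But the a^e with e in a box of
   side proportional to N define a strictly decreasing chain of about N^s ideals
   in this quotient. *)

Require Import Defs.
From mathcomp Require Import all_boot all_order all_algebra.
From mathcomp Require Import boolp classical_sets finmap.
From mathcomp Require Import monalg.
From mathcomp Require Import -(notations) constructive_ereal.
From mathcomp Require Import ring zify.

Set Implicit Arguments.
Unset Strict Implicit.
Unset Printing Implicit Defensive.

Import Order.TTheory GRing.Theory Num.Theory.

Local Open Scope classical_set_scope.
Local Open Scope ring_scope.

(** * Ideals *)

Section Ideals.
Context (R : comPzRingType).
Implicit Types (I J K P Q : set R) (G : set R) (x y u : R).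

(** Polynomials leave the argument at once: a relation at a with least monomial x^e and invertible
    coefficient exists exactly when a^e lies in the ideal generated by the a^f with f above e. A
    finite set of such memberships involves only finitely many comparisons of exponents, which is
    why an arbitrary order can be traded for a weight. The obstacle in (b) is that least terms are
    removed, so that a reduction may climb forever. Modulo large weights only finitely many
    exponents remain, and a version of Krull's intersection theorem at Q lets the bound on the
    weight tend to infinity. The y_j enter the count through the leading coefficients: at Q, some
    power of y_j is one, and all of them occur at a single exponent m; multiplied by a^m, such a
    power gains weight. This is why high powers of the y_j cannot disturb the strictness of the
    chain at exponents of small weight. *)

Definition idl G : set R :=
  [set x | forall I, is_ideal I -> G `<=` I -> I x].

Definition addp I g : set R := [set x | exists r, I (x - r * g)].
Definition colon I g : set R := [set r | I (r * g)].
(* The contraction to R of the extension of I to the localization at Q. *)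
Definition sat Q I : set R := [set x | exists2 u, ~ Q u & I (u * x)].

(* For a prime ideal Q containing I: Q is a minimal prime over I. *)
Definition locrad Q I := forall x, Q x -> exists k, sat Q I (x ^+ k).

Lemma idl_ideal G : is_ideal (idl G).
Proof.
split=> [I [] //|x y Ix Iy I idI GI|a x Ix I idI GI].
  by case: (idI) => _ D _; apply: D; [exact: Ix|exact: Iy].
by case: (idI) => _ _ M; apply: M; exact: Ix.
Qed.

Lemma sub_idl G : G `<=` idl G.
Proof. by move=> x Gx I _; apply. Qed.

Lemma idl_sub G I : is_ideal I -> G `<=` I -> idl G `<=` I.
Proof. by move=> idI GI x; apply. Qed.

Lemma idl_subset G G' : G `<=` G' -> idl G `<=` idl G'.
Proof.
by move=> GG'; apply: (idl_sub (idl_ideal _)) => x /GG'; exact: sub_idl.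
Qed.

Section OneIdeal.
Context (I : set R) (idI : is_ideal I).

Lemma ideal0 : I 0. Proof. by case: idI. Qed.

Lemma idealD x y : I x -> I y -> I (x + y). Proof. by case: idI => _ + _; apply. Qed.

Lemma idealM x y : I y -> I (x * y). Proof. by case: idI => _ _; apply. Qed.

Lemma idealMr x y : I x -> I (x * y). Proof. by rewrite mulrC; exact: idealM. Qed.

Lemma idealN x : I x -> I (- x).
Proof. by rewrite -mulN1r; exact: idealM. Qed.

Lemma idealB x y : I x -> I y -> I (x - y).
Proof. by move=> Ix /idealN; exact: idealD. Qed.

Lemma ideal_sum (T : Type) (s : seq T) (p : pred T) (F : T -> R) :
  (forall i, p i -> I (F i)) -> I (\sum_(i <- s | p i) F i).
Proof. by move=> H; apply: big_ind => //; [exact: ideal0|exact: idealD]. Qed.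

Lemma idealBl x y : I (x - y) -> I y -> I x.
Proof. by move=> Ixy /(idealD Ixy); rewrite subrK. Qed.

Lemma idealX x n : (0 < n)%N -> I x -> I (x ^+ n).
Proof. by case: n => // n _ Ix; rewrite exprS; exact: idealMr. Qed.

Lemma addp_ideal g : is_ideal (addp I g).
Proof.
split=> [|x y [r Ir] [r' Ir']|a x [r Ir]].
- by exists 0; rewrite mul0r subrr; exact: ideal0.
- exists (r + r'); have -> : x + y - (r + r') * g = (x - r * g) + (y - r' * g) by ring.
  exact: idealD.
- exists (a * r); have -> : a * x - a * r * g = a * (x - r * g) by ring.
  exact: idealM.
Qed.

Lemma sub_addp g : I `<=` addp I g.
Proof. by move=> x Ix; exists 0; rewrite mul0r subr0. Qed.

Lemma addp_gen g : addp I g g.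
Proof. by exists 1; rewrite mul1r subrr; exact: ideal0. Qed.

Lemma addp_sub J g : is_ideal J -> I `<=` J -> J g -> addp I g `<=` J.
Proof.
move=> idJ IJ Jg x [r /IJ Jr]; case: (idJ) => _ D M.
by rewrite -(subrK (r * g) x); apply: D => //; exact: M.
Qed.

Lemma colon_ideal g : is_ideal (colon I g).
Proof.
split=> [|x y Ix Iy|a x Ix]; rewrite /colon /=.
- by rewrite mul0r; exact: ideal0.
- by rewrite mulrDl; exact: idealD.
- by rewrite -mulrA; exact: idealM.
Qed.

End OneIdeal.

Section OnePrime.
Context (Q : set R) (prQ : is_prime_ideal Q).

Lemma prime_ideal : is_ideal Q. Proof. by case: prQ. Qed.

Lemma prime1 : ~ Q 1. Proof. by case: prQ. Qed.

Lemma primeM x y : ~ Q x -> ~ Q y -> ~ Q (x * y).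
Proof. by move=> Qx Qy; case: prQ => _ _ /[apply] -[]. Qed.

Lemma primeX x n : Q (x ^+ n) -> Q x.
Proof.
elim: n => [/prime1 //|n IH]; rewrite exprS.
by case: prQ => _ _ /[apply] -[].
Qed.

Lemma primeXN x n : ~ Q x -> ~ Q (x ^+ n).
Proof. by move=> Qx /primeX. Qed.

Lemma primeMl x y : ~ Q x -> Q (x * y) -> Q y.
Proof. by move=> Qx; case: prQ => _ _ /[apply] -[]. Qed.

Lemma sat_ideal I : is_ideal I -> is_ideal (sat Q I).
Proof.
move=> idI; split=> [|x y [u Qu Iu] [v Qv Iv]|a x [u Qu Iu]].
- by exists 1; [exact: prime1|rewrite mulr0; exact: ideal0].
- exists (u * v); first exact: primeM.
  have -> : u * v * (x + y) = v * (u * x) + u * (v * y) by ring.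
  by apply: (idealD idI); exact: (idealM idI).
- by exists u => //; rewrite mulrCA; exact: (idealM idI).
Qed.

Lemma sub_sat I : I `<=` sat Q I.
Proof. by move=> x Ix; exists 1; [exact: prime1|rewrite mul1r]. Qed.

Lemma satS I J : I `<=` J -> sat Q I `<=` sat Q J.
Proof. by move=> IJ x [u Qu /IJ]; exists u. Qed.

Lemma sat_sat I : sat Q (sat Q I) `<=` sat Q I.
Proof.
move=> x [u Qu [v Qv Iv]]; exists (v * u); first exact: primeM.
by rewrite -mulrA.
Qed.

Lemma sat_sub I J : sat Q J `<=` J -> I `<=` J -> sat Q I `<=` J.
Proof. by move=> sJ /satS IJ x /IJ /sJ. Qed.

(** This is the minimality that [locrad] encodes: if [u * x ^+ k] lies in [P] with [u] outside [Q],
    then [u] is outside [P] and primality leaves [x] in [P]. *)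
Lemma locrad_sub P I : is_prime_ideal P -> P `<=` Q -> I `<=` P ->
  locrad Q I -> Q `<=` P.
Proof.
move=> [_ P1 prP] PQ IP rQ x /rQ[k [u Qu /IP /prP [/PQ //|]]].
elim: k => [/P1 //|k IH]; rewrite exprS => /prP[]//.
Qed.

End OnePrime.

Context (noethR : noetherian R).

Lemma noeth_gens I : is_ideal I -> exists s : seq R, I = idl [set` s].
Proof.
move=> idI; have [n [g gI]] := noethR idI; exists [seq g i | i : 'I_n].
rewrite eqEsubset; split.
  rewrite gI => x [c ->]; apply: (ideal_sum (idl_ideal _)) => i _.
  by apply: (idealM (idl_ideal _)); apply: sub_idl; apply: map_f; rewrite mem_enum.
apply: idl_sub => // x /= /mapP[i _ ->]; rewrite gI.
exists (fun j => (j == i)%:R); rewrite (bigD1 i) //= eqxx mul1r big1 ?addr0//.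
by move=> j /negbTE ->; rewrite mul0r.
Qed.

Lemma chain_le (I_ : nat -> set R) : (forall n, I_ n `<=` I_ n.+1) ->
  forall m n, (m <= n)%N -> I_ m `<=` I_ n.
Proof.
move=> H m n /subnK <-; elim: (n - m)%N => // k IH x /IH; exact: H.
Qed.

Lemma bigcup_chain_ideal (I_ : nat -> set R) : (forall n, is_ideal (I_ n)) ->
  (forall n, I_ n `<=` I_ n.+1) -> is_ideal [set x | exists n, I_ n x].
Proof.
move=> idI H; have le := chain_le H.
split=> [|x y [n nx] [m my]|a x [n nx]].
- by exists 0%N; exact: ideal0.
- exists (maxn n m); apply: (idealD (idI _)).
    exact: le (leq_maxl _ _) _ nx.
  exact: le (leq_maxr _ _) _ my.
- by exists n; exact: (idealM (idI n)).
Qed.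

Lemma noeth_chain (I_ : nat -> set R) : (forall n, is_ideal (I_ n)) ->
  (forall n, I_ n `<=` I_ n.+1) -> exists N, forall n, I_ n `<=` I_ N.
Proof.
move=> idI H; have le := chain_le H.
have [s sI] := noeth_gens (bigcup_chain_ideal idI H).
have [N sN] : exists N, forall x, x \in s -> I_ N x.
  have: forall x, x \in s -> exists n, I_ n x.
    move=> x xs; have : [set x | exists n, I_ n x] x by rewrite sI; exact: sub_idl.
    by [].
  elim: s {sI} => [|y s IH] ys; first by exists 0%N.
  have [|N sN] := IH; first by move=> x xs; apply: ys; rewrite inE xs orbT.
  have [n yn] := ys y (mem_head _ _).
  exists (maxn n N) => x; rewrite inE => /orP[/eqP -> |/sN xN].
    exact: le (leq_maxl _ _) _ yn.
  exact: le (leq_maxr _ _) _ xN.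
exists N => n x nx.
have: idl [set` s] x by rewrite -sI; exists n.
exact: (idl_sub (idI N)).
Qed.

Lemma noeth_max (F : set R -> Prop) I0 : is_ideal I0 -> F I0 ->
  exists I, [/\ is_ideal I, F I, I0 `<=` I &
    forall J, is_ideal J -> F J -> I `<=` J -> J `<=` I].
Proof.
move=> idI0 FI0; apply: contrapT => H.
have step (s : {I : set R | is_ideal I /\ F I /\ I0 `<=` I}) :
    {t : {I : set R | is_ideal I /\ F I /\ I0 `<=` I} |
       sval s `<=` sval t /\ ~ sval t `<=` sval s}.
  apply: cid; case: s => I [idI [FI II0]] /=; apply: contrapT => nt.
  apply: H; exists I; split=> // J idJ FJ IJ; apply: contrapT => nJI.
  have pJ : is_ideal J /\ F J /\ I0 `<=` J by split; [|split=> // x /II0 /IJ].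
  by apply: nt; exists (exist _ J pJ).
pose I_ := fix f n := if n is m.+1 then sval (step (f m))
  else exist _ I0 (conj idI0 (conj FI0 (@subset_refl _ I0))).
have [n|n|N] := @noeth_chain (fun n => sval (I_ n)).
- by case: (svalP (I_ n)).
- by case: (svalP (step (I_ n))).
- move=> /(_ N.+1).
  by case: (svalP (step (I_ N))).
Qed.

Lemma noeth_ind (F : set R -> Prop) :
  (forall I, is_ideal I ->
     (forall J, is_ideal J -> I `<` J -> F J) -> F I) ->
  forall I, is_ideal I -> F I.
Proof.
move=> H I idI; apply: contrapT => nFI.
have [J [idJ nFJ _ maxJ]] := noeth_max (F := fun I => ~ F I) idI nFI.
apply: nFJ; apply: H => // K idK [JK nKJ]; apply: contrapT => nFK.
by apply: nKJ; apply: maxJ.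
Qed.

End Ideals.

(** * Minimal primes and heights *)

Section MinimalPrimes.
Context (R : comPzRingType) (noethR : noetherian R).
Implicit Types (I J K P Q : set R) (x y u : R) (l : seq (set R)).

Fixpoint prodset l : set R :=
  if l is P :: l' then [set x | exists p q, [/\ P p, prodset l' q & x = p * q]]
  else [set 1].

Lemma prodset_cat l1 l2 x : prodset (l1 ++ l2) x ->
  exists y z, [/\ prodset l1 y, prodset l2 z & x = y * z].
Proof.
elim: l1 x => [|P l1 IH] x /=; first by move=> lx; exists 1, x; rewrite mul1r.
move=> [p [q [Pp /IH[y [z [ly lz ->]]] ->]]].
by exists (p * y), z; split=> //; [exists p, y|rewrite mulrA].
Qed.

(** Noetherian induction: if [x * y] is in [I] but [x] and [y] are not, the product of I + (x) and I
    + (y) lies in [I], so their lists are concatenated. The unit ideal gets the empty list, whose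
    only product is 1. *)
Lemma prime_decomp I : is_ideal I -> exists l,
  (forall P, P \in l -> is_prime_ideal P /\ I `<=` P) /\ prodset l `<=` I.
Proof.
move=> idI; move: I idI; apply: (noeth_ind noethR) => I idI IH.
have [prI|npI] := pselect (is_prime_ideal I).
  exists [:: I]; split=> [P|x /= [p [q [Ip _ ->]]]].
    by rewrite inE => /eqP ->; split.
  exact: (idealMr idI).
have [I1|nI1] := pselect (I 1).
  by exists [::]; split=> // x /= ->.
have [x [y [Ixy nIx nIy]]] : exists x y, [/\ I (x * y), ~ I x & ~ I y].
  apply: contrapT => H; apply: npI; split=> // x y Ixy.
  have [Ix|nIx] := pselect (I x); [by left|right].
  by apply: contrapT => nIy; apply: H; exists x, y.
have addlt z : ~ I z -> I `<` addp I z.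
  move=> nIz; split; first exact: sub_addp.
  by move=> /(_ z (addp_gen idI z)).
have [l1 [pr1 sub1]] := IH _ (addp_ideal idI x) (addlt x nIx).
have [l2 [pr2 sub2]] := IH _ (addp_ideal idI y) (addlt y nIy).
exists (l1 ++ l2); split=> [P|z /prodset_cat[a [b [/sub1[r Ir] /sub2[t It] ->]]]].
  rewrite mem_cat => /orP[/pr1|/pr2] [prP sP]; split=> //;
  exact: subset_trans (@sub_addp _ _ _) sP.
have -> : a * b = (a - r * x) * b + (r * x) * (b - t * y) + r * t * (x * y) by ring.
apply: (idealD idI); last exact: (idealM idI).
by apply: (idealD idI); [exact: (idealMr idI)|exact: (idealM idI)].
Qed.

Lemma minimal_mem l P : P \in l -> exists Q, [/\ Q \in l, Q `<=` P &
  forall Q', Q' \in l -> Q' `<=` Q -> Q `<=` Q'].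
Proof.
elim: l P => // A l IH P Pl.
have [[P2 P2l P2P]|nP2] := pselect (exists2 P2, P2 \in l & P2 `<=` P).
  have [Q [Ql QP2 minQ]] := IH _ P2l.
  have QP := subset_trans QP2 P2P.
  have [AQ|nAQ] := pselect (A `<=` Q).
    exists A; rewrite mem_head; split=> //; first exact: subset_trans QP.
    move=> Q'; rewrite inE => /orP[/eqP -> //|Q'l Q'A].
    exact: subset_trans AQ (minQ _ Q'l (subset_trans Q'A AQ)).
  exists Q; rewrite inE Ql orbT; split=> // Q'.
  by rewrite inE => /orP[/eqP -> //|]; exact: minQ.
exists P; split=> // Q'; rewrite inE => /orP[/eqP ->|Q'l Q'P].
  by move: Pl; rewrite inE => /orP[/eqP -> //|Pl]; case: nP2; exists P.
by case: nP2; exists Q'.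
Qed.

Lemma prodset_notin l P : is_prime_ideal P ->
  (forall A, A \in l -> ~ A `<=` P) -> exists2 x, prodset l x & ~ P x.
Proof.
move=> prP; elim: l => [|A l IH] nP; first by exists 1 => //; exact: prime1.
have [|x lx Px] := IH; first by move=> B Bl; apply: nP; rewrite inE Bl orbT.
have /nP : A \in A :: l by rewrite mem_head.
move=> /existsNP[a /not_implyP[Aa nPa]].
by exists (a * x); [exists a, x|exact: primeM].
Qed.

(** [Q] is minimal in a list given by [prime_decomp]. Each member of the list either equals [Q] and
    contributes a factor [x], or supplies a factor outside [Q]; the product [u * x ^+ k] lies in
    [I]. *)
Lemma min_prime I P : is_ideal I -> is_prime_ideal P -> I `<=` P ->
  exists Q, [/\ is_prime_ideal Q, I `<=` Q, Q `<=` P & locrad Q I].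
Proof.
move=> idI prP IP; have [l [prl lI]] := prime_decomp idI.
have [P0 P0l P0P] : exists2 P0, P0 \in l & P0 `<=` P.
  apply: contrapT => H; have [A Al|x /lI /IP //] := prodset_notin prP (l := l).
  by move=> AP; apply: H; exists A.
have [Q [Ql QP0 minQ]] := minimal_mem P0l.
have [prQ IQ] := prl _ Ql.
exists Q; split=> //; first exact: subset_trans P0P.
move=> x Qx.
suff [k [u [Qu /lI Iu]]] : exists k u, ~ Q u /\ prodset l (u * x ^+ k).
  by exists k, u.
elim: l {P0l Ql prl lI} minQ => [|A l IH] minQ.
  by exists 0%N, 1; rewrite mulr1; split=> //; exact: prime1.
have [|k [u [Qu lu]]] := IH; first by move=> B Bl; apply: minQ; rewrite inE Bl orbT.
have [AQ|] := pselect (A `<=` Q).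
  have Ax : A x by apply: minQ Qx; rewrite ?mem_head.
  exists k.+1, u; split=> //; exists x, (u * x ^+ k); split=> //.
  by rewrite exprS mulrCA.
move=> /existsNP[a /not_implyP[Aa nQa]].
exists k, (a * u); split; first exact: primeM.
by exists a, (u * x ^+ k); split=> //; rewrite mulrA.
Qed.

Lemma prime_avoidance l I : is_ideal I ->
  (forall P, P \in l -> is_prime_ideal P /\ ~ I `<=` P) ->
  exists2 x, I x & forall P, P \in l -> ~ P x.
Proof.
move=> idI; elim: {l}_.+1 {-2}l (ltnSn (size l)) => // n IH [|Q l] szl prl.
  by exists 0 => //; exact: ideal0.
have [prQ /existsNP[i /not_implyP[Ii nQi]]] := prl Q (mem_head _ _).
have [x Ix ax] : exists2 x, I x & forall P, P \in [seq P <- l | ~~ `[< P `<=` Q >]] -> ~ P x.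
  apply: IH => [|P].
    by apply: leq_trans (szl : (size l < n)%N); rewrite ltnS size_filter count_size.
  by rewrite mem_filter => /andP[_ Pl]; apply: prl; rewrite inE Pl orbT.
have cover y : ~ Q y -> (forall P, P \in [seq P <- l | ~~ `[< P `<=` Q >]] -> ~ P y) ->
    forall P, P \in Q :: l -> ~ P y.
  move=> nQy ay P; rewrite inE => /orP[/eqP -> //|Pl].
  have [PQ /PQ //|nPQ] := pselect (P `<=` Q).
  by apply: ay; rewrite mem_filter Pl andbT; apply/asboolPn.
have [Qx|nQx] := pselect (Q x); last by exists x => //; exact: cover.
have [|z lz nQz] := prodset_notin prQ (l := [seq P <- l | ~~ `[< P `<=` Q >]]).
  by move=> A; rewrite mem_filter => /andP[/asboolPn].
have zP P : P \in [seq P <- l | ~~ `[< P `<=` Q >]] -> P z.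
  have : forall P, P \in [seq P <- l | ~~ `[< P `<=` Q >]] -> is_ideal P.
    by move=> A; rewrite mem_filter => /andP[_ Al]; case: (prl A) => [|[]//]; rewrite inE Al orbT.
  elim: [seq P <- l | _] z lz {nQz} => // A m IHm z [p [q [Ap mq ->]]] idm.
  rewrite inE => /orP[/eqP ->|Pm]; first exact: (idealMr (idm _ (mem_head _ _))).
  apply: (idealM (idm _ _)); first by rewrite inE Pm orbT.
  by apply: IHm => // B Bm; apply: idm; rewrite inE Bm orbT.
(* Here [x] is in [Q] but in no prime of the filtered list, while [i * z] is outside [Q] and in all
   of these; the sum avoids them all. The discarded primes lie inside [Q]. *)
exists (x + i * z); first by apply: (idealD idI) => //; exact: (idealMr idI).
apply: cover => [Qxiz|P Pl Pxiz].
  by apply: (primeM prQ nQi nQz); rewrite -[X in Q X](addKr x) addrC; exact: (idealB (prime_ideal prQ)).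
have idP : is_ideal P.
  move: Pl; rewrite mem_filter => /andP[_ Al].
  by case: (prl P) => [|[]//]; rewrite inE Al orbT.
apply: (ax P Pl); rewrite -(addrK (i * z) x).
by apply: (idealB idP) => //; apply: (idealM idP); exact: zP.
Qed.

End MinimalPrimes.

Section Height.
Context (R : comPzRingType) (noethR : noetherian R).
Implicit Types (I J K P Q : set R) (x y u : R) (l : seq (set R)).

(** For a prime [Q]: the height is at least [n]. The chain need only end inside [Q], so that larger
    primes inherit the property. *)
Definition htge n Q := exists2 P, prime_chain n P & P n `<=` Q.

Lemma htgeS n Q Q' : is_prime_ideal Q -> Q' `<` Q -> htge n Q' -> htge n.+1 Q.
Proof.
move=> prQ [Q'Q nQQ'] [P [prP ltP] PQ'].
exists (fun i => if (i <= n)%N then P i else Q); last by rewrite ltnn.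
split=> i; first by move=> _; case: leqP => // /prP.
rewrite ltnS => le_in; have [->|lt_in] := eqVneq i n; last first.
  have {}lt_in : (i < n)%N by rewrite ltn_neqAle lt_in.
  by rewrite lt_in le_in; exact: ltP.
by rewrite leqnn ltnn; split=> [|QP]; [exact: subset_trans Q'Q|apply: nQQ'; exact: subset_trans QP PQ'].
Qed.

Lemma htge_sub n Q Q' : Q' `<=` Q -> htge n Q' -> htge n Q.
Proof. by move=> Q'Q [P cP PQ']; exists P => //; exact: subset_trans Q'Q. Qed.

Lemma htge0 Q : is_prime_ideal Q -> htge 0 Q.
Proof. by move=> prQ; exists (fun=> Q). Qed.

Lemma prime_chain_leq m n (P : nat -> set R) : (m <= n)%N -> prime_chain n P -> prime_chain m P.
Proof.
move=> mn [prP ltP]; split=> i im; first by apply: prP; exact: leq_trans mn.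
by apply: ltP; exact: leq_trans mn.
Qed.

Lemma parameters d Q : is_prime_ideal Q -> htge d Q ->
  exists y : seq R, [/\ size y = d, [set` y] `<=` Q &
    forall P, is_prime_ideal P -> [set` y] `<=` P -> htge d P].
Proof.
move=> prQ htQ; suff: forall i, (i <= d)%N -> exists y : seq R,
    [/\ size y = i, [set` y] `<=` Q &
    forall P, is_prime_ideal P -> [set` y] `<=` P -> htge i P] by apply.
elim=> [|i IH] id_.
  by exists [::]; split=> // P prP _; exact: htge0.
have [y [szy yQ hty]] := IH (ltnW id_).
have idy := idl_ideal [set` y].
have [l [prl subl]] := prime_decomp noethR idy.
(* The primes to avoid are those of the decomposition not yet of height [i.+1]; none contains [Q],
   whose height is at least [d]. A prime over the longer list contains some [A] of the
   decomposition, and either [A] is high enough or [x] makes the inclusion strict. *)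
have [x Qx ax] : exists2 x, Q x & forall P, P \in [seq P <- l | ~~ `[< htge i.+1 P >]] -> ~ P x.
  apply: prime_avoidance; first exact: prime_ideal.
  move=> P; rewrite mem_filter => /andP[/asboolPn nht /prl[prP _]]; split=> // QP.
  apply: nht; apply: htge_sub QP _.
  case: htQ => Pc cP PQ; exists Pc; first exact: prime_chain_leq cP.
  apply: subset_trans PQ; move: id_; rewrite leq_eqVlt => /orP[/eqP <- //|id_].
  move: cP => [_ ltP].
  have: forall j, (i.+1 <= j <= d)%N -> Pc i.+1 `<=` Pc j.
    elim=> // j IHj /andP[]; rewrite leq_eqVlt => /orP[/eqP <- _ x //|ij jd].
    have PP : Pc i.+1 `<=` Pc j by apply: IHj; rewrite -ltnS ij ltnW.
    by case: (ltP j jd) => + _; exact: subset_trans.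
  by move=> /(_ d); apply; rewrite ltnW ?leqnn.
exists (x :: y); split=> /=; first by rewrite szy.
  by move=> z /=; rewrite inE => /orP[/eqP -> //|]; exact: yQ.
move=> P prP xyP.
have yP : [set` y] `<=` P by move=> z /= zy; apply: xyP; rewrite /= inE zy orbT.
have Px : P x by apply: xyP; rewrite /= mem_head.
have [A Al AP] : exists2 A, A \in l & A `<=` P.
  apply: contrapT => H; have [A Al|z /subl lz nPz] := prodset_notin prP (l := l).
    by move=> AP; apply: H; exists A.
  by apply: nPz; apply: (idl_sub (prime_ideal prP)) lz.
have [prA yA] := prl _ Al.
have htA : htge i A by apply: hty => //; exact: subset_trans (@sub_idl _ _) yA.
have [htA1|nhtA] := pselect (htge i.+1 A); first exact: htge_sub AP htA1.
apply: htgeS htA => //; split=> // PA.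
apply: (ax A); last exact: PA.
by rewrite mem_filter Al andbT; apply/asboolPn.
Qed.

End Height.

(** * Krull's height theorem *)

Section LocalAlgebra.
Context (R : comPzRingType) (noethR : noetherian R).
Implicit Types (I J K P Q A B : set R) (x y u : R).

Definition mulset Q B : set R := [set z | exists q b, [/\ Q q, B b & z = q * b]].

(** The generators of [B] are eliminated one at a time: modulo [J] and the remaining ones, [h] is at
    [Q] a multiple of itself by an element of [Q]. With denominators cleared, the unit that kills
    [h] is [u * w - q]. *)
Lemma nakayama Q B J : is_prime_ideal Q -> is_ideal B -> is_ideal J ->
  B `<=` sat Q (idl (J `|` mulset Q B)) -> B `<=` sat Q J.
Proof.
move=> prQ idB idJ BQ.
have idQ := prime_ideal prQ.
have [g gB] := noeth_gens noethR idB.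
pose W (l : seq R) := idl (J `|` [set` l]).
have idW l : is_ideal (W l) by exact: idl_ideal.
have WJ : W [::] `<=` J by apply: idl_sub => // x [].
apply: subset_trans (satS WJ).
have : B `<=` sat Q (W g).
  rewrite gB; apply: subset_trans (@sub_sat _ _ prQ _).
  by apply: idl_subset => x; right.
have : {subset g <= B} by move=> x xg; apply/mem_set; rewrite gB; exact: sub_idl.
elim: g {gB} => // h l IH hlB BW; apply: IH => [x xl|].
  by apply: hlB; rewrite inE xl orbT.
have Bh : B h by apply/set_mem/hlB; rewrite mem_head.
pose D := [set z | exists u q, [/\ ~ Q u, Q q & W l (u * z - q * h)]].
have idD : is_ideal D.
  split=> [|x y [u [q [Qu Qq Wx]]] [v [q' [Qv Qq' Wy]]]|a x [u [q [Qu Qq Wx]]]].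
  - exists 1, 0; split; [exact: prime1|exact: ideal0|].
    by rewrite mulr0 mul0r subrr; exact: ideal0.
  - exists (u * v), (v * q + u * q'); split; first exact: primeM.
      by apply: (idealD idQ); exact: (idealM idQ).
    have -> : u * v * (x + y) - (v * q + u * q') * h =
      v * (u * x - q * h) + u * (v * y - q' * h) by ring.
    by apply: (idealD (idW l)); exact: (idealM (idW l)).
  - exists u, (a * q); split=> //; first exact: (idealM idQ).
    have -> : u * (a * x) - a * q * h = a * (u * x - q * h) by ring.
    exact: (idealM (idW l)).
have Whl b : B b -> exists u r, ~ Q u /\ W l (u * b - r * h).
  move=> /BW[u Qu Wu]; exists u.
  have: addp (W l) h (u * b).
    apply: (idl_sub (addp_ideal (idW l) h)) Wu => x [Jx|/=].
      by apply: sub_addp; apply: sub_idl; left.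
    rewrite inE => /orP[/eqP ->|xl]; first exact: addp_gen.
    by apply: sub_addp; apply: sub_idl; right.
  by case=> r Wr; exists r.
have JD : J `|` mulset Q B `<=` D.
  move=> x [Jx|[q [b [Qq /Whl[u [r [Qu Wb]]] ->]]]].
    exists 1, 0; split; [exact: prime1|exact: ideal0|].
    by rewrite mul1r mul0r subr0; apply: sub_idl; left.
  exists u, (q * r); split=> //; first exact: (idealMr idQ).
  have -> : u * (q * b) - q * r * h = q * (u * b - r * h) by ring.
  exact: (idealM (idW l)).
have [w Qw /(idl_sub idD JD)[u [q [Qu Qq Wh]]]] := BQ h Bh.
have Qv : ~ Q (u * w - q).
  by move=> /(idealD idQ) /(_ Qq); rewrite subrK; exact: primeM.
move=> b /Whl[v [r [Qv' Wb]]].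
exists ((u * w - q) * v); first exact: primeM.
have -> : (u * w - q) * v * b =
   (u * w - q) * (v * b - r * h) + r * (u * (w * h) - q * h) by ring.
by apply: (idealD (idW l)); apply: (idealM (idW l)).
Qed.

(** For a prime [Q], contraction identifies these with the ideals of the localization at [Q]. *)
Definition satid Q A := is_ideal A /\ sat Q A `<=` A.

(* An upper bound L for the length of R_Q / I_Q, expressed by a strictly
   monotone function on the saturated ideals above I. *)
Definition length_le Q I L := exists phi : set R -> nat,
  forall A B, satid Q A -> satid Q B -> I `<=` A -> A `<=` B ->
    [/\ (phi B <= L)%N, (phi A <= phi B)%N & (phi B <= phi A)%N -> B `<=` A].

Lemma length_leW Q I J L : (forall A, satid Q A -> J `<=` A -> I `<=` A) ->
  length_le Q I L -> length_le Q J L.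
Proof.
move=> JI [phi H]; exists phi => A B sA sB JA AB; apply: H => //; exact: JI.
Qed.

Lemma length_le_unit Q I : I 1 -> length_le Q I 0.
Proof.
move=> I1; exists (fun=> 0%N) => A B [idA _] _ IA AB; split=> // _ x _.
by rewrite -(mulr1 x); apply: (idealM idA); exact: IA.
Qed.

Lemma length_le_prime Q : is_prime_ideal Q -> length_le Q Q 1.
Proof.
move=> prQ; exists (fun A => `[< A 1 >] : nat) => A B [idA sA] [idB sB] QA AB.
have QX X : satid Q X -> Q `<=` X -> X 1 \/ X = Q.
  move=> [idX sX] QsX; have [XQ|] := pselect (X `<=` Q).
    by right; rewrite eqEsubset.
  move=> /existsNP[x /not_implyP[Xx Qx]]; left; apply: sX; exists x => //.
  by rewrite mulr1.
split; first by case: asboolP.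
  by case: asboolP => // /AB B1; rewrite asboolT.
case: (asboolP (A 1)) => [A1 _ x _|nA1].
  by rewrite -(mulr1 x); exact: (idealM idA).
case: asboolP => // nB1 _.
have [//|->] := QX A (conj idA sA) QA.
have [//|->//] := QX B (conj idB sB) (subset_trans QA AB).
Qed.

(** Additivity of length along R/(I : g) -> R/I -> R/(I + (g)): if [A] lies in [B] and both have, at
    [Q], the same sum with (g) and the same colon by [g], they are equal. *)
Lemma length_le_add Q I J g L1 L2 : is_prime_ideal Q ->
  length_le Q (addp I g) L1 -> length_le Q J L2 -> J `<=` colon I g ->
  length_le Q I (L1 + L2).
Proof.
move=> prQ [p1 H1] [p2 H2] JI.
exists (fun A => p1 (sat Q (addp A g)) + p2 (colon A g))%N => A B [idA sA] [idB sB] IA AB.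
have sadd X : is_ideal X -> satid Q (sat Q (addp X g)).
  move=> idX; split; last exact: sat_sat.
  by apply: sat_ideal => //; exact: addp_ideal.
have scol X : satid Q X -> satid Q (colon X g).
  move=> [idX sX]; split; first exact: colon_ideal.
  by move=> x [u Qu Xu]; apply: sX; exists u => //; rewrite mulrA.
have [||||b1 m1 e1] := H1 (sat Q (addp A g)) (sat Q (addp B g)).
- exact: sadd.
- exact: sadd.
- apply: subset_trans (@sub_sat _ _ prQ _) => x [r /IA Ar]; by exists r.
- by apply: satS => x [r /AB Br]; exists r.
have [||||b2 m2 e2] := H2 (colon A g) (colon B g).
- exact: scol.
- exact: scol.
- by apply: subset_trans JI _ => x /IA.
- by move=> x /AB.
split; [exact: leq_add|exact: leq_add|move=> le x Bx].
have {}e1 : sat Q (addp B g) `<=` sat Q (addp A g) by apply: e1; lia.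
have {}e2 : colon B g `<=` colon A g by apply: e2; lia.
have [u Qu [r Ar]] : sat Q (addp A g) x.
  by apply: e1; apply: sub_sat => //; exact: sub_addp.
have Brg : B (r * g).
  have -> : r * g = u * x - (u * x - r * g) by ring.
  by apply: (idealB idB); [exact: (idealM idB)|exact: AB].
by apply: sA; exists u => //; apply: (idealBl idA Ar); exact: e2.
Qed.

Lemma length_le_exp Q G x n L : is_prime_ideal Q ->
  length_le Q (idl (G `|` [set x])) L ->
  length_le Q (idl (G `|` [set x ^+ n])) (n * L).
Proof.
move=> prQ Hx; elim: n => [|n IH].
  by apply: length_le_unit; apply: sub_idl; right; rewrite expr0.
rewrite mulSn addnC.
apply: (@length_le_add _ _ (idl (G `|` [set x])) (x ^+ n)) => //.
  apply: length_leW IH => A [idA _] H; apply: (idl_sub idA) => y Gy; apply: H.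
  case: Gy => [Gy|->]; last exact: (addp_gen (idl_ideal _)).
  by apply: sub_addp; apply: sub_idl; left.
apply: idl_sub; first exact: (colon_ideal (idl_ideal _)).
move=> y [Gy|->]; rewrite /colon /=.
  by apply: (idealMr (idl_ideal _)); apply: sub_idl; left.
by apply: sub_idl; right; rewrite -exprS.
Qed.

(** The number of elements bounds the degree of growth in [n], which part (b) compares with the
    number of the a_i. [G] varies because it absorbs the other elements while one of them is raised
    to its power. *)
Lemma length_le_exps Q G (s : seq R) n L : is_prime_ideal Q ->
  length_le Q (idl (G `|` [set` s])) L ->
  length_le Q (idl (G `|` [set` [seq x ^+ n | x <- s]])) (n ^ size s * L).
Proof.
move=> prQ; elim: s G L => [|x s IH] G L HL /=; first by rewrite expn0 mul1n.
have /IH {}HL : length_le Q (idl ((G `|` [set x]) `|` [set` s])) L.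
  apply: length_leW HL => A _; apply: subset_trans; apply: idl_subset => y.
  by case=> [Gy|/=]; [by left; left|rewrite inE => /orP[/eqP ->|]; [left|]; right].
rewrite expnS -mulnA.
have : length_le Q (idl ((G `|` [set` [seq x ^+ n | x <- s]]) `|` [set x])) (n ^ size s * L).
  apply: length_leW HL => A _; apply: subset_trans; apply: idl_subset => y.
  by case=> [[Gy|->]|ys]; [left; left|right|left; right].
move=> /(length_le_exp n prQ).
apply: length_leW => A _; apply: subset_trans; apply: idl_subset => y.
case=> [[Gy|ys]|->]; [by left|right|right].
  by move: ys; rewrite /= inE => ->; rewrite orbT.
by rewrite /= mem_head.
Qed.

Lemma sat_pow_le Q I x m n : is_prime_ideal Q -> is_ideal I -> (m <= n)%N ->
  sat Q I (x ^+ m) -> sat Q I (x ^+ n).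
Proof.
move=> prQ idI mn Ix; rewrite -(subnK mn) exprD.
exact: (idealM (sat_ideal prQ idI)).
Qed.

Lemma locrad_exponent Q I (s : seq R) : is_prime_ideal Q -> is_ideal I ->
  locrad Q I -> [set` s] `<=` Q ->
  exists k, forall x, x \in s -> sat Q I (x ^+ k).
Proof.
move=> prQ idI rQ; elim: s => [|x s IH] sQ; first by exists 0%N.
have [|k kP] := IH; first by move=> y /= ys; apply: sQ; rewrite /= inE ys orbT.
have [j jP] := rQ x (sQ x (mem_head _ _)).
exists (maxn j k) => y; rewrite inE => /orP[/eqP ->|/kP].
  by apply: sat_pow_le jP => //; exact: leq_maxl.
by apply: sat_pow_le => //; exact: leq_maxr.
Qed.

(** At [Q], the ideal [Q] has colength 1 and a common power of its generators lies in [I];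
    [length_le_exps] bounds the colength of the ideal of these powers. *)
Lemma locrad_length Q I : is_prime_ideal Q -> is_ideal I -> locrad Q I ->
  exists L, length_le Q I L.
Proof.
move=> prQ idI rQ; have [h hQ] := noeth_gens noethR (prime_ideal prQ).
have [k kP] : exists k, forall x, x \in h -> sat Q I (x ^+ k).
  apply: locrad_exponent => // x xh; rewrite hQ; exact: sub_idl.
have : length_le Q (idl (set0 `|` [set` h])) 1.
  by rewrite set0U -hQ; exact: length_le_prime.
move=> /(length_le_exps k prQ) HL; exists (k ^ size h * 1)%N.
apply: length_leW HL => A [idA sA] IA; apply: (idl_sub idA) => x [//|/=].
by move=> /mapP[y /kP yI ->]; apply: sA; exact: satS yI.
Qed.

(** Krull's argument in the domain R/P0, with the powers of one [b] in [P1] outside [P0] instead of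
    symbolic powers of [P1]: [B n] is the contraction of P0 + (b^n) from the localization at [P1].
    Finite length makes [B n] and [B n.+1] agree modulo [y] at [Q] for some [n], Nakayama removes
    [y], and b^n becomes a multiple of b^(n+1) at [P1]. *)
Lemma principal_ideal_theorem P0 P1 Q y : is_prime_ideal P0 -> is_prime_ideal P1 ->
  is_prime_ideal Q -> P0 `<` P1 -> P1 `<` Q -> Q y -> ~ locrad Q (addp P0 y).
Proof.
move=> prP0 prP1 prQ [P01 nP10] [P1Q nQP1] Qy rQ.
have idP0 := prime_ideal prP0; have idP1 := prime_ideal prP1.
have nP1y : ~ P1 y.
  move=> P1y; apply: nQP1; apply: (locrad_sub prP1 P1Q _ rQ).
  exact: addp_sub.
have [L [phi Hphi]] := locrad_length prQ (addp_ideal idP0 y) rQ.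
have [b [P1b nP0b]] : exists b, P1 b /\ ~ P0 b.
  by move/existsNP: nP10 => [b /not_implyP]; exists b.
pose B n := [set r | exists u t, ~ P1 u /\ P0 (u * r - t * b ^+ n)].
have idB n : is_ideal (B n).
  split=> [|r r' [u [t [P1u Br]]] [u' [t' [P1u' Br']]]|a r [u [t [P1u Br]]]].
  - exists 1, 0; split; first exact: prime1.
    by rewrite mulr0 mul0r subrr; exact: ideal0.
  - exists (u * u'), (u' * t + u * t'); split; first exact: primeM.
    have -> : u * u' * (r + r') - (u' * t + u * t') * b ^+ n =
      u' * (u * r - t * b ^+ n) + u * (u' * r' - t' * b ^+ n) by ring.
    by apply: (idealD idP0); exact: (idealM idP0).
  - exists u, (a * t); split=> //.
    have -> : u * (a * r) - a * t * b ^+ n = a * (u * r - t * b ^+ n) by ring.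
    exact: (idealM idP0).
have BS n : B n.+1 `<=` B n.
  move=> r [u [t [P1u Br]]]; exists u, (t * b); split=> //.
  by rewrite -mulrA -exprS.
have BP0 n : P0 `<=` B n.
  move=> r P0r; exists 1, 0; split; first exact: prime1.
  by rewrite mul0r subr0 mul1r.
have sB n : sat P1 (B n) `<=` B n.
  move=> r [u P1u [v [t [P1v P0v]]]]; exists (v * u), t; split; first exact: primeM.
  by rewrite -mulrA.
pose C n := sat Q (addp (B n) y).
have sC n : satid Q (C n).
  split; last exact: sat_sat.
  by apply: (sat_ideal prQ); exact: addp_ideal.
have CP0 n : addp P0 y `<=` C n.
  apply: subset_trans (@sub_sat _ _ prQ _) => x [r /(@BP0 n) Br]; by exists r.
have CS n : C n.+1 `<=` C n by apply: satS => x [r /BS Br]; exists r.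
have [n Cn] : exists n, C n `<=` C n.+1.
  apply: contrapT => nC.
  have H n : (phi (C n.+1) < phi (C n))%N.
    have [_ _ H] := Hphi _ _ (sC n.+1) (sC n) (CP0 _) (CS n).
    by rewrite ltnNge; apply/negP => /H; apply: contra_not nC => ?; exists n.
  have {}H n : (phi (C n) + n <= phi (C 0%N))%N.
    by elim: n => [|n IH]; [rewrite addn0|move: (H n); lia].
  by move: (H (phi (C 0%N)).+1); lia.
(* As [y] is outside [P1], [y * r] in [B n] gives [r] in [B n]. So [B n] lies at [Q] in the sum of
   [B n.+1] and y times [B n]. *)
have BQ : B n `<=` sat Q (B n.+1).
  apply: nakayama => // x Bx.
  have [|u Qu [r Br]] := Cn x; first by apply: sub_sat => //; exact: sub_addp.
  have Bnr : B n r.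
    apply: sB; exists y => //.
    have -> : y * r = u * x - (u * x - r * y) by ring.
    by apply: (idealB (idB n)); [exact: (idealM (idB n))|exact: BS].
  exists u => //; rewrite -(subrK (r * y) (u * x)).
  apply: (idealD (idl_ideal _)); apply: sub_idl; first by left.
  by right; exists y, r; rewrite mulrC.
have [|u Qu [v [t [P1v P0v]]]] := BQ (b ^+ n).
  exists 1, 1; split; first exact: prime1.
  by rewrite subrr; exact: ideal0.
have P1u : ~ P1 u by move=> /P1Q.
apply: (primeM prP1 P1v P1u); apply: (idealBl idP1 (y := t * b)); last exact: (idealM idP1).
apply: P01; apply: (primeMl prP0 (x := b ^+ n)); first exact: primeXN.
by have -> : b ^+ n * (v * u - t * b) = v * (u * b ^+ n) - t * b ^+ n.+1 by rewrite exprS; ring.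
Qed.

(** A prime [P'] just below [Q] misses some [y0], and [Q] is minimal over P' + (y0); so each other
    [z] has a power that is at [Q] congruent modulo [y0] to an element [f z] of [P']. As [P'] has
    height at least [d.+1], induction shows that a minimal prime [P''] over the [d] elements [f z]
    is strictly smaller. But [Q] is minimal over P'' + (y0) too, against the principal ideal
    theorem. *)
Lemma height_le d Q (y : seq R) : is_prime_ideal Q -> size y = d ->
  [set` y] `<=` Q -> locrad Q (idl [set` y]) -> ~ htge d.+1 Q.
Proof.
elim: d Q y => [|d IH] Q y prQ szy yQ rQ [P [prP ltP] PQ].
  have [_] : P 0 `<` P 1 by exact: ltP.
  apply; apply: (subset_trans PQ).
  apply: (locrad_sub (prP 0%N isT) _ _ rQ).
    by apply: (subset_trans _ PQ); case: (ltP 0%N isT).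
  apply: (idl_sub (prime_ideal (prP 0%N isT))) => x /=.
  by rewrite (size0nil szy).
have prPd := prP d.+1 (leqnSn _).
have [PPd nPPd] : P d.+1 `<` P d.+2 by exact: ltP.
have [P' [_ [prP' ltP'Q] PdP' maxP']] := noeth_max noethR
   (F := fun P' => is_prime_ideal P' /\ P' `<` Q) (I0 := P d.+1) (prime_ideal prPd)
   (conj prPd (conj (subset_trans PPd PQ) (fun QP => nPPd (subset_trans PQ QP)))).
have [P'Q nQP'] := ltP'Q.
have idP' := prime_ideal prP'.
have [y0 y0y nP'y0] : exists2 y0, y0 \in y & ~ P' y0.
  apply: contrapT => H; apply: nQP'; apply: (locrad_sub prP' P'Q _ rQ).
  apply: (idl_sub idP') => x xy; apply: contrapT => nP'x; apply: H; by exists x.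
have Qy0 : Q y0 by exact: yQ.
have minQ I : is_ideal I -> addp I y0 `<=` Q ->
    (forall Q', is_prime_ideal Q' -> addp I y0 `<=` Q' -> Q' `<=` Q -> Q `<=` Q') ->
    locrad Q (addp I y0).
  move=> idI IQ H; have [Q' [prQ' IQ' Q'Q rQ']] := min_prime noethR (addp_ideal idI y0) prQ IQ.
  suff -> : Q = Q' by [].
  by rewrite eqEsubset; split=> //; exact: H.
have rP' : locrad Q (addp P' y0).
  apply: minQ => //; first exact: (addp_sub (prime_ideal prQ)).
  move=> Q' prQ' IQ' Q'Q; apply: contrapT => nQQ'.
  apply: nP'y0; apply: (maxP' Q'); [exact: prime_ideal|by []| |].
    by apply: subset_trans IQ'; exact: sub_addp.
  by apply: IQ'; exact: addp_gen.
pose y' := rem y0 y.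
have szy' : size y' = d by rewrite size_rem // szy.
have y'Q : [set` y'] `<=` Q by move=> x /= /mem_rem; exact: yQ.
have yy' x : x \in y -> x = y0 \/ x \in y'.
  move=> xy; have [->|nxy] := eqVneq x y0; first by left.
  by right; move: xy; rewrite (perm_mem (perm_to_rem y0y)) inE (negbTE nxy).
have [f fP] : exists f : R -> R, forall z, z \in y' -> P' (f z) /\
    exists k u r, ~ Q u /\ f z = u * z ^+ k - r * y0.
  have: forall z, exists fz, z \in y' -> P' fz /\
      exists k u r, ~ Q u /\ fz = u * z ^+ k - r * y0.
    move=> z; have [zy'|] := pselect (z \in y'); last by exists 0.
    have [k [u Qu [r P'r]]] := rP' z (y'Q z zy').
    by exists (u * z ^+ k - r * y0) => _; split=> //; exists k, u, r.
  by move=> /choice[f fP]; exists f.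
pose p := [seq f z | z <- y'].
have pP' : [set` p] `<=` P' by move=> x /= /mapP[z /fP[P'f _] ->].
have [P'' [prP'' pP'' P''P' rP'']] := min_prime noethR (idl_ideal [set` p]) prP'
   (idl_sub idP' pP').
have [P'P''|nP'P''] := pselect (P' `<=` P'').
  have eqP : P' = P'' by rewrite eqEsubset.
  apply: (IH P' p) => //; first by rewrite size_map.
    by rewrite eqP.
  by exists P => //; apply: (prime_chain_leq _ (conj prP ltP)).
apply: (principal_ideal_theorem prP'' prP' prQ _ ltP'Q Qy0); first by [].
have idP'' := prime_ideal prP''.
apply: minQ => //.
  apply: (addp_sub (prime_ideal prQ)) => //; exact: subset_trans P''P' P'Q.
move=> Q' prQ' IQ' Q'Q; have idQ' := prime_ideal prQ'.
apply: (locrad_sub prQ' Q'Q _ rQ); apply: (idl_sub idQ') => x /= /yy'[->|].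
  by apply: IQ'; exact: addp_gen.
move=> xy'; have [_ [k [u [r [Qu fx]]]]] := fP x xy'.
apply: (primeX prQ' (n := k)); apply: (primeMl prQ' (x := u)); first by move=> /Q'Q.
apply: IQ'; exists r; rewrite -fx; apply: pP''; apply: sub_idl; exact: map_f.
Qed.

End LocalAlgebra.

(** * Orders and weights on exponents *)

Section Exponents.
Context (s : nat).
Local Notation exps := {ffun 'I_s -> nat}.
Implicit Types (e f g : exps) (X : set exps).

Definition expdvd e f := forall i, (e i <= f i)%N.

Lemma expdvdP e f : expdvd e f -> exists g, f = e + g.
Proof.
move=> ef; exists [ffun i => f i - e i]%N; apply/ffunP => i.
by rewrite !ffunE /= -[RHS]/(e i + (f i - e i))%N subnKC.
Qed.

Lemma ffun_addE e f i : (e + f) i = (e i + f i)%N.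
Proof. by rewrite ffunE. Qed.

Lemma ffun_mulnE e n i : (e *+ n) i = (e i * n)%N.
Proof.
elim: n => [|n IH]; first by rewrite mulr0n muln0 ffunE.
by rewrite mulrSr ffun_addE IH mulnSr.
Qed.

Lemma dickson X : exists B : seq exps,
  {subset B <= X} /\ forall e, X e -> exists2 b, b \in B & expdvd b e.
Proof.
suff /(_ s X) [B [BX HB]] : forall k X, exists B : seq exps, {subset B <= X} /\
    forall e, X e -> exists2 b, b \in B & forall i : 'I_s, (i < k)%N -> (b i <= e i)%N.
  by exists B; split=> // e /HB[b bB be]; exists b => // i; exact: be.
elim=> [|k IH] {}X.
  have [[e Xe]|nX] := pselect (exists e, X e).
    exists [:: e]; split=> [b|f _]; last by exists e => //; rewrite mem_head.
    by rewrite inE => /eqP ->; exact/mem_set.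
  by exists [::]; split=> // e Xe; case: nX; exists e.
have [B [BX HB]] := IH X.
have [ltks|geks] := ltnP k s; last first.
  exists B; split=> // e /HB[b bB be]; exists b => // i _; apply: be.
  exact: leq_trans geks.
pose ik := Ordinal ltks.
(* Exponents with coordinate [k] at least [N] are served by [B] itself; the others fall into [N]
   slices where this coordinate is constant. *)
have [N NP] : exists N, forall b, b \in B -> (b ik <= N)%N.
  exists (\max_(b <- B) b ik) => b bB.
  by rewrite (big_rem b) //= leq_maxl.
have [C [CX HC]] : exists C : seq exps, {subset C <= X} /\ forall e, X e ->
    (e ik < N)%N -> exists2 b, b \in C & forall i : 'I_s, (i < k.+1)%N -> (b i <= e i)%N.
  elim: N {NP} => [|N [C [CX HC]]]; first by exists [::].
  have [D [DX HD]] := IH [set e | X e /\ e ik = N].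
  exists (C ++ D); split=> [b|e Xe].
    rewrite mem_cat => /orP[/CX //|/DX /set_mem[Xb _]]; exact/mem_set.
  rewrite ltnS leq_eqVlt => /orP[/eqP eN|/(HC e Xe)[b bC be]]; last first.
    by exists b => //; rewrite mem_cat bC.
  have [|b bD be] := HD e; first by [].
  exists b; first by rewrite mem_cat bD orbT.
  move=> i; rewrite ltnS leq_eqVlt => /orP[/eqP ik'|]; last exact: be.
  have -> : i = ik by exact: val_inj.
  by have /set_mem[_ ->] := DX b bD; rewrite eN.
exists (B ++ C); split=> [b|e Xe]; first by rewrite mem_cat => /orP[/BX|/CX].
have [lt|ge] := ltnP (e ik) N.
  by have [b bC be] := HC e Xe lt; exists b => //; rewrite mem_cat bC orbT.
have [b bB be] := HB e Xe; exists b; first by rewrite mem_cat bB.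
move=> i; rewrite ltnS leq_eqVlt => /orP[/eqP ik'|]; last exact: be.
have -> : i = ik by exact: val_inj.
exact: leq_trans (NP b bB) ge.
Qed.

Record exp_order (lt : exps -> exps -> Prop) : Prop := ExpOrder {
  exp_irr : forall e, ~ lt e e;
  exp_trans : forall e f g, lt e f -> lt f g -> lt e g;
  exp_total : forall e f, [\/ lt e f, e = f | lt f e];
  exp_gt0 : forall e, e <> 0 -> lt 0 e;
  exp_add : forall e f g, lt e f -> lt (e + g) (f + g)
}.

Section Order.
Context (lt : exps -> exps -> Prop) (ltP : exp_order lt).

Lemma expdvd_le e f : expdvd e f -> e = f \/ lt e f.
Proof.
move=> /expdvdP[g ->]; have [->|/eqP g0] := eqVneq g 0; first by left; rewrite addr0.
by right; have := exp_add ltP e (exp_gt0 ltP g0); rewrite add0r addrC.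
Qed.

Lemma exp_add2l e f g : lt e f -> lt (g + e) (g + f).
Proof. by rewrite ![g + _]addrC; exact: exp_add. Qed.

Lemma exp_add2 e f e' f' : lt e f -> lt e' f' -> lt (e + e') (f + f').
Proof. by move=> ef /(exp_add2l f); exact: exp_trans (exp_add ltP e' ef). Qed.

Lemma exp_min_seq (B : seq exps) b0 : b0 \in B ->
  exists2 b, b \in B & forall c, c \in B -> b = c \/ lt b c.
Proof.
elim: B b0 => // a B IH b0 _.
have [[b1 b1B]|nB] := pselect (exists b1, b1 \in B); last first.
  exists a; rewrite ?mem_head// => c; rewrite inE => /orP[/eqP -> |cB]; first by left.
  by case: nB; exists c.
have [b bB minb] := IH _ b1B.
have [lt_ab|ab|lt_ba] := exp_total ltP a b.
- exists a; rewrite ?mem_head// => c; rewrite inE => /orP[/eqP ->|/minb[<-|]]; [by left|by right|right].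
  exact: exp_trans lt_ab _.
- exists a; rewrite ?mem_head// => c; rewrite inE => /orP[/eqP ->|]; [by left|].
  by rewrite ab; exact: minb.
- exists b; rewrite ?inE ?bB ?orbT// => c; rewrite inE => /orP[/eqP ->|/minb//].
  by right.
Qed.

(** By Dickson's lemma, every inaccessible exponent is divisible by a member of a finite set of
    inaccessible ones; whatever is below the least member is then accessible. *)
Lemma exp_wf : well_founded lt.
Proof.
move=> e; apply: contrapT => ne.
have [B [BX HB]] := dickson [set e | ~ Acc lt e].
have [b0 b0B _] := HB e ne.
have [b bB minb] := exp_min_seq b0B.
have /set_mem := BX b bB; apply; constructor => f fb; apply: contrapT => nf.
have [c cB cf] := HB f nf.
have bf : b = f \/ lt b f.
  have [->|bc] := minb c cB; first exact: expdvd_le.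
  by right; have [<-|] := expdvd_le cf => //; exact: exp_trans bc.
by case: bf fb => [->|bf fb]; [exact: exp_irr|apply: (exp_irr ltP (exp_trans ltP bf fb))].
Qed.

End Order.

Definition wt (w : 'I_s -> nat) e := (\sum_i w i * e i)%N.

Lemma wtD w e f : wt w (e + f) = (wt w e + wt w f)%N.
Proof. by rewrite /wt -big_split; apply: eq_bigr => i _; rewrite ffun_addE mulnDr. Qed.

Lemma wtMn w e n : wt w (e *+ n) = (wt w e * n)%N.
Proof.
by rewrite /wt big_distrl; apply: eq_bigr => i _; rewrite ffun_mulnE mulnA.
Qed.

Local Notation vec := {ffun 'I_s -> int}.

Definition dot (w v : vec) : int := \sum_i w i * v i.

Lemma dotDr w v v' : dot w (v + v') = dot w v + dot w v'.
Proof. by rewrite /dot -big_split; apply: eq_bigr => i _; rewrite ffunE mulrDr. Qed.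

Lemma dotDl w w' v : dot (w + w') v = dot w v + dot w' v.
Proof. by rewrite /dot -big_split; apply: eq_bigr => i _; rewrite ffunE mulrDl. Qed.

Lemma dotMnr w v n : dot w (v *+ n) = dot w v * n%:Z.
Proof.
elim: n => [|n IH]; last by rewrite !mulrSr dotDr IH; lia.
by rewrite mulr0n mulr0 /dot big1 // => i _; rewrite ffunE mulr0.
Qed.

Lemma dotNl w v : dot (- w) v = - dot w v.
Proof. by rewrite /dot -sumrN; apply: eq_bigr => i _; rewrite ffunE mulNr. Qed.

Lemma dotMnl w v n : dot (w *+ n) v = dot w v * n%:Z.
Proof.
elim: n => [|n IH]; last by rewrite !mulrSr dotDl IH; lia.
by rewrite mulr0n mulr0 /dot big1 // => i _; rewrite ffunE mul0r.
Qed.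

(** Values of [v] on [l] are positive integers, hence at least 1, so a large multiple of [v]
    outweighs [u] there without changing its value at [d]. *)
Lemma dot_perturb (l : seq vec) d v u : dot v d = 0 -> 0 < dot u d ->
  (forall x, x \in l -> 0 < dot v x) ->
  exists w, forall x, x \in d :: l -> 0 < dot w x.
Proof.
move=> vd ud lP.
have [K KP] : exists K : nat, forall x, x \in l -> - dot u x < K%:Z.
  elim: l {lP} => [|x l [K KP]]; first by exists 0%N.
  exists (K + `|dot u x|.+1)%N => y; rewrite inE => /orP[/eqP ->|/KP]; lia.
exists (v *+ K + u) => x; rewrite inE dotDl dotMnl => /orP[/eqP ->|xl].
  by rewrite vd mul0r add0r.
have vx := lP x xl.
have : K%:Z <= dot v x * K%:Z by rewrite -{1}[K%:Z]mul1r ler_wpM2r //; lia.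
by have := KP x xl; lia.
Qed.

(* Induction on the number of vectors: when the functional w found for l is
   negative at d, the vectors of l are projected along d to the hyperplane
   w = 0. *)
Lemma positive_functional (pos : vec -> Prop) (l : seq vec) :
  ~ pos 0 -> (forall x y, pos x -> pos y -> pos (x + y)) ->
  (forall x, x \in l -> pos x) ->
  exists w, forall x, x \in l -> 0 < dot w x.
Proof.
move=> pos0 posD; move: {2}(size l) (erefl (size l)) => n.
have posMn x m : pos x -> (0 < m)%N -> pos (x *+ m).
  case: m => // m px _; elim: m => [|m IH]; first by rewrite mulr1n.
  by rewrite mulrS; exact: posD.
elim: n l => [|n IH] [|d l] //= szl lP; first by exists 0.
have {}szl : size l = n by case: szl.
have [w wl] := IH l szl (fun x xl => lP x (mem_behead (s := d :: l) xl)).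
have pd : pos d by apply: lP; exact: mem_head.
have [wd|wd|wd] := ltrgt0P (dot w d).
- by exists w => x; rewrite inE => /orP[/eqP ->|/wl].
(* [h x] is [p] times the projection of [x] to the kernel of [w]: the scaling keeps it integral, and
   both coefficients are positive, so it stays in [pos]. Below, [v] is the composite of [w'] with
   [h]. *)
- pose p := `|dot w d|%N; pose h x := x *+ p + d *+ `|dot w x|%N.
  have p0 : (0 < p)%N by rewrite /p; lia.
  have [||w' wl'] := IH [seq h x | x <- l]; first by rewrite size_map.
    move=> y /mapP[x xl ->]; apply: posD; apply: posMn => //.
      by apply: lP; rewrite inE xl orbT.
    by have := wl x xl; lia.
  pose c := dot w' d.
  pose v := if 0 <= c then w' *+ p + w *+ `|c|%N else w' *+ p - w *+ `|c|%N.
  have vE x : dot v x = dot w' x * p%:Z + dot w x * c.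
    rewrite /v; case: (lerP 0 c) => c0; rewrite dotDl ?dotNl !dotMnl.
      by rewrite gez0_abs.
    by rewrite ltz0_abs // mulrN opprK.
  apply: (@dot_perturb l d v (- w)).
  - by rewrite vE /p -/c ltz0_abs // mulrN mulrC addNr.
  - by rewrite dotNl; lia.
  move=> x xl; have := wl' (h x) (map_f h xl).
  rewrite /h vE dotDr !dotMnr -/c (gez0_abs (ltW (wl x xl))).
  by rewrite [c * _]mulrC.
- have [i di] : exists i, d i != 0.
    apply: contrapT => H; apply: pos0.
    suff -> : 0 = d by [].
    by apply/ffunP => i; rewrite ffunE; apply/esym/eqP; apply: contrapT => /negP di; apply: H; exists i.
  apply: (@dot_perturb l d w [ffun j => d i * (j == i)%:R]) => //.
  rewrite /dot (bigD1 i) //= big1 => [|j /negbTE ji]; rewrite ffunE ?ji ?mulr0 ?mul0r//.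
  by rewrite eqxx mulr1 addr0; move: di; rewrite -sqrf_eq0 lt0r -expr2 sqr_ge0 => ->.
Qed.

(** Compatibility with addition makes the differences of comparable exponents closed under sums, and
    irreflexivity keeps 0 out of them. *)
Lemma weight_approx (lt : exps -> exps -> Prop) (D : seq (exps * exps)) :
  exp_order lt -> (forall p, p \in D -> lt p.1 p.2) ->
  exists w, (forall i, 0 < w i)%N /\
    forall p, p \in D -> (wt w p.1 < wt w p.2)%N.
Proof.
move=> ltP DP.
pose diff (p : exps * exps) : vec := [ffun i => (p.2 i)%:Z - (p.1 i)%:Z].
pose pos v := exists2 p : exps * exps, lt p.1 p.2 & v = diff p.
pose unit_ (i : 'I_s) : exps := [ffun j => nat_of_bool (j == i)].
(* The unit vectors are above 0 in the order; adding them makes the weights positive. *)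
pose D' := D ++ [seq (0, unit_ i) | i <- enum 'I_s].
have D'P p : p \in D' -> lt p.1 p.2.
  rewrite mem_cat => /orP[/DP //|/mapP[i _ ->]] /=; apply: exp_gt0 => //.
  by move=> /ffunP /(_ i); rewrite !ffunE eqxx.
have [|||w wP] := @positive_functional pos [seq diff p | p <- D'].
- move=> [p ltp /ffunP p0]; suff pE : p.1 = p.2 by move: ltp; rewrite pE; exact: exp_irr.
  by apply/ffunP => i; move/eqP: (p0 i); rewrite !ffunE eq_sym subr_eq0 => /eqP[].
- move=> x y [p ltp ->] [q ltq ->].
  exists (p.1 + q.1, p.2 + q.2); first exact: exp_add2.
  by apply/ffunP => i; rewrite !ffunE /=; lia.
- by move=> x /mapP[p /D'P ltp ->]; exists p.
have dotE p : dot w (diff p) = \sum_i w i * (p.2 i)%:Z - \sum_i w i * (p.1 i)%:Z.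
  by rewrite -sumrB; apply: eq_bigr => i _; rewrite ffunE mulrBr.
have w0 i : 0 < w i.
  have := wP (diff (0, unit_ i)); rewrite dotE /= => H.
  have : (0, unit_ i) \in D' by rewrite mem_cat map_f ?orbT ?mem_enum.
  move=> /(map_f diff) /H; rewrite [X in _ - X]big1 => [|j _]; last by rewrite ffunE mulr0.
  rewrite (bigD1 i) //= big1 => [|j /negbTE ji]; rewrite ffunE ?ji ?eqxx ?mulr0//.
  by rewrite addr0 mulr1 subr0.
exists (fun i => `|w i|%N); split=> [i|p pD]; first by rewrite absz_gt0 gt_eqF.
have wtE e : (wt (fun i => `|w i|%N) e)%:Z = \sum_i w i * (e i)%:Z.
  rewrite /wt -[LHS]natz natr_sum; apply: eq_bigr => i _.
  by rewrite natz PoszM gez0_abs // ltW.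
by have := wP (diff p); rewrite dotE -!wtE map_f ?mem_cat ?pD// => /(_ isT); rewrite subr_gt0 ltz_nat.
Qed.

End Exponents.

(** * Monomials and part (a) *)

Section Monomials.
Context (R : comPzRingType) (s : nat) (a : 'I_s -> R).
Local Notation exps := {ffun 'I_s -> nat}.
Implicit Types (e f g : exps) (T : set exps) (x y u : R).

Definition mon e : R := \prod_i a i ^+ e i.

Definition Sp T : set R := idl [set mon e | e in T].

Lemma monD e f : mon (e + f) = mon e * mon f.
Proof. by rewrite -big_split; apply: eq_bigr => i _; rewrite ffun_addE exprD. Qed.

Lemma mon0 : mon 0 = 1.
Proof. by rewrite /mon big1 // => i _; rewrite ffunE expr0. Qed.

Lemma monMn e n : mon (e *+ n) = mon e ^+ n.
Proof.
elim: n => [|n IH]; first by rewrite mulr0n mon0 expr0.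
by rewrite mulrSr monD IH exprSr.
Qed.

Lemma Sp_ideal T : is_ideal (Sp T). Proof. exact: idl_ideal. Qed.

Lemma Sp_mon T e : T e -> Sp T (mon e).
Proof. by move=> Te; apply: sub_idl; exists e. Qed.

Lemma Sp_sub T I : is_ideal I -> (forall e, T e -> I (mon e)) -> Sp T `<=` I.
Proof. by move=> idI H; apply: idl_sub => // x [e /H ? <-]. Qed.

Lemma SpS T T' : T `<=` T' -> Sp T `<=` Sp T'.
Proof. by move=> TT'; apply: idl_subset => x [e /TT' T'e <-]; exists e. Qed.

Lemma Sp_mul T T' T'' x y : (forall e f, T e -> T' f -> T'' (e + f)) ->
  Sp T x -> Sp T' y -> Sp T'' (x * y).
Proof.
move=> H Tx T'y; have idT := Sp_ideal T''.
rewrite -[Sp T'' _]/(colon (Sp T'') y x).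
apply: (Sp_sub (colon_ideal idT y) _ Tx) => e Te; rewrite /colon /= mulrC.
rewrite -[Sp T'' _]/(colon (Sp T'') (mon e) y).
apply: (Sp_sub (colon_ideal idT _) _ T'y) => f T'f.
by rewrite /colon /= -monD addrC; apply: Sp_mon; exact: H.
Qed.

Lemma Sp_mulmon T T' g x : (forall e, T e -> T' (e + g)) ->
  Sp T x -> Sp T' (x * mon g).
Proof.
move=> H Tx; have Tg : Sp [set g] (mon g) by exact: Sp_mon.
by apply: Sp_mul Tx Tg => e _ Te ->; exact: H.
Qed.

Lemma Sp_wt_exp w v x n : Sp [set f | (v <= wt w f)%N] x ->
  Sp [set f | (v * n <= wt w f)%N] (x ^+ n).
Proof.
move=> Hx; elim: n => [|n IH].
  by rewrite muln0 expr0 -mon0; apply: Sp_mon.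
rewrite exprS; apply: Sp_mul Hx IH => e f /= He Hf.
by rewrite wtD mulnS leq_add.
Qed.

Lemma Sp_finite T x : Sp T x -> exists F : seq exps,
  {subset F <= T} /\ Sp [set` F] x.
Proof.
pose D := [set x | exists F : seq exps, {subset F <= T} /\ Sp [set` F] x].
suff idD : is_ideal D.
  apply: (Sp_sub idD) => e Te; exists [:: e]; split=> [f|].
    by rewrite inE => /eqP ->; exact/mem_set.
  by apply: Sp_mon; rewrite /= mem_head.
split=> [|y z [F [FT Fy]] [G [GT Gz]]|b y [F [FT Fy]]].
- by exists [::]; split=> //; exact: (ideal0 (Sp_ideal _)).
- exists (F ++ G); split=> [f|]; first by rewrite mem_cat => /orP[/FT|/GT].
  apply: (idealD (Sp_ideal _)).
    by apply: SpS Fy => f /= fF; rewrite mem_cat fF.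
  by apply: SpS Gz => f /= fF; rewrite mem_cat fF orbT.
- by exists F; split=> //; exact: (idealM (Sp_ideal _)).
Qed.

End Monomials.

Section Congruence.
Context (R : comPzRingType) (I : set R) (idI : is_ideal I).
Implicit Types x y : R.

Lemma congM x x' y y' : I (x - x') -> I (y - y') -> I (x * y - x' * y').
Proof.
move=> Ix Iy; have -> : x * y - x' * y' = (x - x') * y + x' * (y - y') by ring.
by apply: (idealD idI); [exact: (idealMr idI)|exact: (idealM idI)].
Qed.

Lemma congX x x' n : I (x - x') -> I (x ^+ n - x' ^+ n).
Proof.
move=> Ix; elim: n => [|n IH]; first by rewrite !expr0 subrr; exact: ideal0.
by rewrite !exprS; exact: congM.
Qed.

End Congruence.

Section IndependentSequences.
Context (R : comPzRingType) (noethR : noetherian R) (s : nat) (a : 'I_s.+1 -> R).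
Local Notation exps := {ffun 'I_s.+1 -> nat}.

(* The relation is raised to the power w_0 (S + 1), where S is the sum of the
   weights, to absorb the rounding errors in the exponents f_i %/ w_0. *)
Lemma parameters_independent Q (lt : exps -> exps -> Prop) e :
  is_prime_ideal Q -> (forall i, Q (a i)) ->
  locrad Q (idl [set x | exists i, x = a i]) ->
  htge s.+1 Q -> exp_order lt -> ~ Sp a (lt e) (mon a e).
Proof.
move=> prQ Qa rQ htQ ltP /Sp_finite[F [FT Fe]].
have [w [w0 wP]] : exists w, (forall i, 0 < w i)%N /\
    forall p, p \in [seq (e, f) | f <- F] -> (wt w p.1 < wt w p.2)%N.
  by apply: (weight_approx ltP) => p /mapP[f /FT /set_mem ltf ->].
have {FT Fe} He : Sp a [set f | ((wt w e).+1 <= wt w f)%N] (mon a e).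
  by apply: SpS Fe => f fF; apply: (wP (e, f)); exact: map_f.
pose c := w ord0; pose x := a ord0.
pose y := [seq a (lift ord0 j) ^+ c - x ^+ w (lift ord0 j) | j <- enum 'I_s].
have idQ := prime_ideal prQ.
have yQ : [set` y] `<=` Q.
  by move=> z /= /mapP[j _ ->]; apply: (idealB idQ); apply: (idealX idQ); first [exact: w0|exact: Qa].
have [Q' [prQ' yQ' Q'Q rQ']] := min_prime noethR (idl_ideal [set` y]) prQ (idl_sub idQ yQ).
have idQ' := prime_ideal prQ'.
have cong i : Q' (a i ^+ c - x ^+ w i).
  case: (unliftP ord0 i) => [j ->|->]; last by rewrite subrr; exact: ideal0.
  by apply: yQ'; apply: sub_idl; apply: map_f; rewrite mem_enum.
suff Q'x : Q' x.
  have QQ' : Q `<=` Q'.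
    apply: (locrad_sub prQ' Q'Q _ rQ); apply: (idl_sub idQ') => _ [i ->].
    apply: (primeX prQ' (n := c)); apply: (idealBl idQ' (cong i)).
    exact: (idealX idQ').
  have eqQ : Q = Q' by rewrite eqEsubset.
  apply: (height_le noethR prQ (y := y) (d := s)) => //.
    by rewrite size_map size_enum_ord.
  by rewrite eqQ.
apply: contrapT => nQ'x.
pose Z j := addp Q' (x ^+ j).
have idZ j : is_ideal (Z j) by exact: addp_ideal.
have ZM j k u v : Z j u -> Z k v -> Z (j + k)%N (u * v).
  move=> [r ur] [t vt]; exists (r * t).
  have -> : r * t * x ^+ (j + k) = r * x ^+ j * (t * x ^+ k) by rewrite exprD; ring.
  exact: congM.
have Zle j k : (j <= k)%N -> Z k `<=` Z j.
  move=> jk u [r ur]; exists (r * x ^+ (k - j)).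
  by rewrite -mulrA -exprD subnK.
have Za i n : Z (w i * (n %/ c))%N (a i ^+ n).
  exists (a i ^+ (n %% c)); rewrite {1}(divn_eq n c) exprD [X in _ - X]mulrC.
  apply: (congM idQ'); last by rewrite subrr; exact: ideal0.
  by rewrite mulnC !exprM; exact: congX.
have Zmon (f : exps) : Z (\sum_i w i * (f i %/ c))%N (mon a f).
  rewrite /mon; elim/big_ind2: _ => //; last by move=> j u k v; exact: ZM.
  by exists 1; rewrite expr0 mulr1 subrr; exact: ideal0.
pose S := (\sum_i w i)%N.
(* Rounding [f i] down to a multiple of [c] loses less than [c], so the total loss of weight is at
   most [c * S]. *)
have wt_le (f : exps) : (wt w f <= c * (\sum_i w i * (f i %/ c) + S))%N.
  rewrite /wt /S -big_split big_distrr /=; apply: leq_sum => i _.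
  rewrite -[X in (_ + X)%N]muln1 -mulnDr addn1 mulnCA leq_mul2l; apply/orP; right.
  by rewrite mulnC ltnW // -ltn_divLR // w0.
have Zwt j (f : exps) : (c * (j + S) <= wt w f)%N -> Z j (mon a f).
  move=> /leq_trans /(_ (wt_le f)); rewrite leq_pmul2l ?w0// leq_add2r => /Zle.
  by apply.
(* Since (v + 1)(S + 1) = k + 1 + S, the excess weight 1 of the relation, multiplied by c(S + 1),
   covers the loss cS and leaves one more factor [x] than the k that the power of [mon a e]
   contains. *)
pose v := wt w e; pose k := (v * S.+1)%N.
have Hk : Z k.+1 (mon a e ^+ (c * S.+1)).
  apply: (Sp_sub (idZ _) _ (Sp_wt_exp (n := (c * S.+1)%N) He)) => f /= Hf.
  apply: Zwt; apply: leq_trans Hf; rewrite /k /v.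
  by rewrite mulnCA leq_mul2l; apply/orP; right; rewrite mulSn; lia.
have ce : Q' (mon a e ^+ c - x ^+ v).
  rewrite /mon /v /wt -prodrXl.
  elim/big_ind2: _ => [|u j u' j' Hu Hu'|i _].
  - by rewrite expr0 subrr; exact: ideal0.
  - by rewrite exprD; exact: congM.
  - by rewrite -exprM mulnC !exprM; exact: congX.
have [r xr] : Z k.+1 (x ^+ k).
  case: Hk => r Hr; exists r; move: Hr; set M := mon a e ^+ _ => Hr.
  have -> : x ^+ k - r * x ^+ k.+1 = (M - r * x ^+ k.+1) - (M - x ^+ k).
    by rewrite opprB [RHS]addrC addrA addrNK.
  apply: (idealB idQ') => //.
  by rewrite /M /k !exprM; exact: congX.
(* Cancelling [x ^+ k] in the domain R/Q' would make [x] a unit modulo [Q'], although it lies in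
   [Q]. *)
have : Q' (1 - r * x).
  apply: (primeMl prQ' (x := x ^+ k)); first exact: primeXN.
  by have -> : x ^+ k * (1 - r * x) = x ^+ k - r * x ^+ k.+1 by rewrite exprS; ring.
move=> /Q'Q Q1; apply: (prime1 prQ); apply: (idealBl idQ Q1).
by apply: (idealM idQ); exact: Qa.
Qed.

End IndependentSequences.

(** * Leading ideals *)

Section KrullIntersection.
Context (R : comPzRingType) (noethR : noetherian R).
Implicit Types (I J K Q : set R) (x y u : R).

(** A [K] that is maximal for having its intersection with [B] inside [sat Q I0] takes the place of
    the Artin-Rees lemma. It contains a power of each element of [g], hence some [I_ N], hence [B]
    at [Q]; so [B] is at [Q] inside J + QB, and Nakayama applies. *)
Lemma krull_intersection Q J (I_ : nat -> set R) (g : seq R) :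
  is_prime_ideal Q -> is_ideal J -> [set` g] `<=` Q ->
  (forall K, is_ideal K -> (forall x, x \in g -> exists n, K (x ^+ n)) ->
     exists N, I_ N `<=` K) ->
  forall x, (forall N, sat Q (idl (J `|` I_ N)) x) -> sat Q J x.
Proof.
move=> prQ idJ gQ HI; have idQ := prime_ideal prQ.
pose B := [set x | forall N, sat Q (idl (J `|` I_ N)) x].
have idS N : is_ideal (sat Q (idl (J `|` I_ N))).
  by apply: sat_ideal => //; exact: idl_ideal.
have idB : is_ideal B.
  split=> [N|y z By Bz N|b y By N].
  - exact: (ideal0 (idS N)).
  - by apply: (idealD (idS N)).
  - by apply: (idealM (idS N)).
pose I0 := idl (J `|` mulset Q B); have idI0 : is_ideal I0 by exact: idl_ideal.
suff : B `<=` sat Q J by [].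
apply: (nakayama noethR prQ idB idJ).
have [|K [idK FK I0K maxK]] :=
  noeth_max noethR (F := fun K => K `&` B `<=` sat Q I0) idI0.
  by move=> y [I0y _]; exact: sub_sat.
have [|N IN] := HI K idK.
  move=> b bg; have Qb := gQ b bg.
  have [n|n y|n Hn] := noeth_chain noethR (I_ := fun n => colon K (b ^+ n)).
  - exact: colon_ideal.
  - by rewrite /colon /= exprSr mulrA; exact: (idealMr idK).
  (* If [y] in [B] is congruent to r b^n modulo [K], then [b * y] is in QB, hence in [K]. So r
     b^(n+1) is in [K], and then r b^n is, as the colon ideals are stationary from [n] on. *)
  exists n; apply: (maxK (addp K (b ^+ n))).
  - exact: addp_ideal.
  - move=> y [[r Kr] By]; apply: FK; split=> //.
    apply: (idealBl idK Kr); apply: (Hn n.+1); rewrite /colon /=.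
    have -> : r * b ^+ n.+1 = b * y - b * (y - r * b ^+ n) by rewrite exprS; ring.
    apply: (idealB idK); last exact: (idealM idK).
    by apply: I0K; apply: sub_idl; right; exists b, y.
  - exact: sub_addp.
  - exact: addp_gen.
have JK : idl (J `|` I_ N) `<=` K.
  by apply: idl_sub => // y [Jy|/IN //]; apply: I0K; apply: sub_idl; left.
move=> x Bx; have [u Qu /JK Kux] := Bx N.
apply: (sat_sat prQ); exists u => //; apply: FK; split=> //.
exact: (idealM idB).
Qed.

End KrullIntersection.

Section Dependence.
Context (R : comPzRingType) (noethR : noetherian R) (s : nat).
Local Notation exps := {ffun 'I_s -> nat}.

(** A form of Hilbert's basis theorem for monomially graded ideals. Among the [e] with [I] inside
    [c e], those with equality need only Dickson's lemma; the others lie above finitely many [b]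
    with [c b] larger, where Noetherian induction applies. *)
Lemma noeth_family (c : exps -> set R) : (forall e, is_ideal (c e)) ->
  (forall e f, expdvd e f -> c e `<=` c f) ->
  exists B : seq exps, forall e, exists b, [/\ b \in B, expdvd b e & c e `<=` c b].
Proof.
move=> idc cS.
suff [B HB] : exists B : seq exps, forall e, c 0 `<=` c e ->
    exists b, [/\ b \in B, expdvd b e & c e `<=` c b].
  by exists B => e; apply: HB; apply: cS => i; rewrite ffunE.
move: (c 0) (idc 0); apply: (noeth_ind noethR) => I idI IH.
have [B0 [B0P HB0]] := dickson [set e | c e = I].
have [B1 [B1P HB1]] := dickson [set e | I `<` c e].
have [B2 HB2] : exists B2 : seq exps, forall e, (exists2 b, b \in B1 & expdvd b e) ->
    exists b, [/\ b \in B2, expdvd b e & c e `<=` c b].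
  elim: B1 B1P {HB1} => [|b B1 IHB] B1P; first by exists [::] => e [].
  have [|B2 HB2] := IHB; first by move=> f fB; apply: B1P; rewrite inE fB orbT.
  have /set_mem Ib := B1P b (mem_head _ _).
  have [B3 HB3] := IH (c b) (idc b) Ib.
  exists (B2 ++ B3) => e [d]; rewrite inE => /orP[/eqP ->|dB1] de.
    have [d' [d'B d'e ed']] := HB3 e (cS _ _ de).
    by exists d'; rewrite mem_cat d'B orbT.
  have [|d' [d'B d'e ed']] := HB2 e; first by exists d.
  by exists d'; rewrite mem_cat d'B.
exists (B0 ++ B2) => e Ie; have [eI|neI] := pselect (c e `<=` I).
  have [|b bB be] := HB0 e; first by rewrite /= eqEsubset.
  exists b; rewrite mem_cat bB; split=> //.
  by have /set_mem -> := B0P b bB.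
have [b [bB be eb]] := HB2 e (HB1 e (conj Ie neI)).
by exists b; rewrite mem_cat bB orbT.
Qed.

Context (a : 'I_s -> R) (lt : exps -> exps -> Prop) (ltP : exp_order lt).
Local Notation mon := (mon a).
Local Notation Sp := (Sp a).

(* The coefficients of [x^e] in the polynomials that vanish at [a] and have no
   term below [x^e]. *)
Definition lead_ideal e : set R := colon (Sp (lt e)) (mon e).

Lemma lead_ideal_ideal e : is_ideal (lead_ideal e).
Proof. exact: (colon_ideal (Sp_ideal _ _)). Qed.

Lemma lead_idealS e f : expdvd e f -> lead_ideal e `<=` lead_ideal f.
Proof.
move=> /expdvdP[g ->] r; rewrite /lead_ideal /colon /= monD mulrA => Hr.
apply: Sp_mulmon Hr => e' lt_e'.
exact: exp_add.
Qed.

(** One weight serves all [e] and [r] because finitely many relations suffice: every leading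
    coefficient at [e] already occurs at one of finitely many [b] dividing [e], each [lead_ideal b]
    is finitely generated, and each generator needs finitely many exponents. *)
Lemma lead_ideal_weight : exists w, (forall i, 0 < w i)%N /\
  forall e r, lead_ideal e r ->
    Sp [set f | lt e f /\ (wt w e < wt w f)%N] (r * mon e).
Proof.
have [B HB] := noeth_family lead_ideal_ideal lead_idealS.
have [D DP] : exists D : exps -> seq exps, forall b,
    (forall f, f \in D b -> lt b f) /\ forall r, lead_ideal b r -> Sp [set` D b] (r * mon b).
  suff : forall b, exists D : seq exps, (forall f, f \in D -> lt b f) /\
      forall r, lead_ideal b r -> Sp [set` D] (r * mon b).
    by move=> /choice[D DP]; exists D.
  move=> b; have [g gP] := noeth_gens noethR (lead_ideal_ideal b).
  have {gP} : (forall r, r \in g -> lead_ideal b r) /\ lead_ideal b `<=` idl [set` g].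
    by rewrite gP; split=> // r rg; exact: sub_idl.
  move=> [gb bg]; suff [D [Db Dg]] : exists D : seq exps, (forall f, f \in D -> lt b f) /\
      forall r, r \in g -> Sp [set` D] (r * mon b).
    exists D; split=> // r /bg.
    exact: (idl_sub (colon_ideal (Sp_ideal _ _) _)).
  elim: g gb {bg} => [|x g IH] gb; first by exists [::].
  have [|D [Db Dg]] := IH; first by move=> r rg; apply: gb; rewrite inE rg orbT.
  have [F [FT HF]] := Sp_finite (gb x (mem_head _ _)).
  exists (F ++ D); split=> [f|r]; first by rewrite mem_cat => /orP[/FT/set_mem|/Db].
  rewrite inE => /orP[/eqP ->|/Dg].
    by apply: SpS HF => f /= fF; rewrite mem_cat fF.
  by apply: SpS => f /= fF; rewrite mem_cat fF orbT.
have [|w [w0 wP]] := @weight_approx s lt (flatten [seq [seq (b, f) | f <- D b] | b <- B]) ltP.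
  move=> p /flatten_mapP[b _ /mapP[f fD ->]] /=.
  by have [/(_ f fD)] := DP b.
exists w; split=> // e r er; have [b [bB /expdvdP[g eE] eb]] := HB e.
have /eb br := er; have [Db HD] := DP b.
rewrite eE monD mulrA.
apply: Sp_mulmon (HD r br) => f /= fD.
split; first by apply: exp_add => //; exact: Db.
rewrite !wtD ltn_add2r; apply: (wP (b, f)).
by apply/flatten_mapP; exists b => //; exact: map_f.
Qed.

Section Weighted.
Context (Q : set R) (prQ : is_prime_ideal Q) (Qa : forall i, Q (a i)).
Context (w : 'I_s -> nat) (w0 : forall i, (0 < w i)%N).
Context (wP : forall e r, lead_ideal e r ->
    Sp [set f | lt e f /\ (wt w e < wt w f)%N] (r * mon e)).

Lemma wt_ge (e : exps) i : (e i <= wt w e)%N.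
Proof. by rewrite /wt (bigD1 i) //= (leq_trans _ (leq_addr _ _)) // leq_pmull. Qed.

Lemma wt_finite N : exists S : seq exps, forall e : exps, (wt w e < N)%N -> e \in S.
Proof.
exists [seq [ffun i => nat_of_ord (h i)] | h : {ffun 'I_s -> 'I_N}] => e eN.
have lti i : (e i < N)%N by exact: leq_ltn_trans (wt_ge e i) eN.
apply/mapP; exists [ffun i => Ordinal (lti i)]; first by rewrite mem_enum.
by apply/ffunP => i; rewrite !ffunE.
Qed.

Lemma wt_filtration K : is_ideal K ->
  (forall x, x \in [seq a i | i : 'I_s] -> exists n, K (x ^+ n)) ->
  exists N, Sp [set f | (N <= wt w f)%N] `<=` K.
Proof.
move=> idK HK.
have [n nP] : exists n : 'I_s -> nat, forall i, K (a i ^+ n i).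
  suff : forall i, exists n, K (a i ^+ n) by move=> /choice[n nP]; exists n.
  by move=> i; apply: HK; apply: map_f; rewrite mem_enum.
(* Any weight above this sum forces some [f i] to reach [n i]. *)
exists (\sum_i w i * n i).+1; apply: Sp_sub => // f /= Hf.
have [i ni] : exists i, (n i <= f i)%N.
  apply: contrapT => H; move: Hf; rewrite ltnNge => /negP; apply.
  apply: leq_sum => i _; rewrite leq_mul2l; apply/orP; right.
  by rewrite leqNgt; apply/negP => lt_nf; apply: H; exists i; exact: ltnW.
rewrite /mon (bigD1 i) //= -(subnK ni) exprD -mulrA mulrC.
by rewrite -mulrA; apply: (idealMr idK).
Qed.

(* The terms below [x^e] are removed one at a time, the least one first: by
   induction its coefficient is in the local leading ideal, so that it can be
   replaced by terms that are larger for both the order and the weight. Since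
   this may not terminate, it is done modulo arbitrarily large weights. *)
Lemma lead_ideal_mod_weight e r N : (wt w e < N)%N ->
  sat Q (Sp [set f | lt e f \/ (N <= wt w f)%N]) (r * mon e) ->
  sat Q (lead_ideal e) r.
Proof.
elim/(well_founded_ind (exp_wf ltP)): e r N => e IHe r N eN Hr.
pose U N1 (V : seq exps) := Sp [set f | [\/ lt e f, (N1 <= wt w f)%N | f \in V]].
have idU N1 V : is_ideal (U N1 V) by exact: Sp_ideal.
(* [V] holds the exponents still to be removed: below [e], of weight from [N] up to [N1], and upward
   closed among these, so that the replacement terms stay within reach. As [N] exceeds the weight of
   [e], [e] itself never reappears. *)
have step N1 (V : seq exps) : (N <= N1)%N ->
    (forall f, f \in V -> [/\ lt f e, (N <= wt w f)%N & (wt w f < N1)%N]) ->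
    (forall f f', f \in V -> lt f f' -> lt f' e -> (N <= wt w f')%N ->
       (wt w f' < N1)%N -> f' \in V) ->
    sat Q (U N1 V) (r * mon e) -> sat Q (U N1 [::]) (r * mon e).
  move=> NN1; elim: {V}_.+1 {-2}V (ltnSn (size V)) => // n IHn [|v0 V0] // szV VP Vup HV.
  have vV := mem_head v0 V0; move: (v0 :: V0) szV VP Vup HV vV => V szV VP Vup HV vV.
  have [g gV ming] := exp_min_seq ltP vV.
  have [lt_ge Ng gN1] := VP g gV.
  pose V' := [seq f <- V | f != g].
  have V'P f : f \in V -> f \in V' \/ f = g.
    by move=> fV; have [->|fg] := eqVneq f g; [right|left; rewrite mem_filter fg].
  have V'V f : f \in V' -> f \in V /\ lt g f.
    rewrite mem_filter => /andP[fg fV]; split=> //.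
    by have [gf|//] := ming f fV; rewrite gf eqxx in fg.
  apply: (IHn V').
  - apply: leq_trans (szV : (size V <= n)%N); rewrite size_filter -(count_predC (pred1 g) V).
    by rewrite -addn1 addnC leq_add2r -has_count has_pred1.
  - by move=> f /V'V[/VP].
  - move=> f f' /V'V[fV gf] ff' f'e Nf' f'N.
    rewrite mem_filter (Vup f f') // andbT; apply/eqP => f'g.
    by apply: (exp_irr ltP (exp_trans ltP gf _)); rewrite -f'g.
  have [u Qu] := HV.
  have : U N1 V `<=` addp (U N1 V') (mon g).
    apply: Sp_sub; first exact: addp_ideal.
    move=> f /= fU; have [->|fg] := pselect (f = g); first exact: addp_gen.
    apply: sub_addp; apply: Sp_mon; case: fU => [?|?|/V'P[?|//]];
    by [apply: Or31|apply: Or32|apply: Or33].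
  move=> sub /sub[q Hq].
  (* All other terms are above [g] or of weight at least [N1], so induction applies to [g] with [N1]
     as the bound. *)
  have [v Qv vq] : sat Q (lead_ideal g) q.
    apply: (IHe g lt_ge q N1 gN1); apply: sub_sat => //.
    have -> : q * mon g = u * (r * mon e) - (u * (r * mon e) - q * mon g) by ring.
    apply: (idealB (Sp_ideal _ _)).
      by apply: (idealM (Sp_ideal _ _)); apply: (idealM (Sp_ideal _ _)); apply: Sp_mon; left.
    apply: SpS Hq => f /= [ef|?|/V'V[_ ?]]; [left|by right|by left].
    exact: exp_trans lt_ge ef.
  exists (v * u); first exact: primeM.
  have -> : v * u * (r * mon e) = v * (u * (r * mon e) - q * mon g) + v * q * mon g by ring.
  apply: (idealD (idU _ _)); first exact: (idealM (idU _ _)).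
  apply: SpS (wP vq) => f [gf wgf] /=.
  have Nf : (N <= wt w f)%N by exact: leq_trans Ng (ltnW wgf).
  have [ef|ef|fe] := exp_total ltP e f; first exact: Or31.
    by move: Nf; rewrite -ef leqNgt eN.
  have [fN1|] := ltnP (wt w f) N1; last by move=> _; apply: Or32.
  apply: Or33; have [//|fg] := V'P f (Vup g f gV gf fe Nf fN1).
  by case: (exp_irr ltP (e := f)); rewrite {1}fg.
have : sat Q (Sp (lt e)) (r * mon e).
  apply: (krull_intersection noethR (I_ := fun N1 => Sp [set f | (N1 <= wt w f)%N])
     (g := [seq a i | i : 'I_s])) => //.
  - exact: Sp_ideal.
  - by move=> x /= /mapP[i _ ->].
  - exact: wt_filtration.
  move=> N1.
  have [S SP] := wt_finite (maxn N N1).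
  pose V := [seq f <- S | `[< [/\ lt f e, (N <= wt w f)%N & (wt w f < maxn N N1)%N] >]].
  have VE f : f \in V <-> [/\ lt f e, (N <= wt w f)%N & (wt w f < maxn N N1)%N].
    rewrite mem_filter; split=> [/andP[/asboolP]//|fV].
    by rewrite asboolT // SP //; case: fV.
  have : sat Q (U (maxn N N1) [::]) (r * mon e).
    apply: (step _ V); first exact: leq_maxl.
    - by move=> f /VE.
    - by move=> f f' _ _ ? ? ?; apply/VE.
    apply: satS Hr; apply: SpS => f /= [?|Nf]; first exact: Or31.
    have [fN1|] := ltnP (wt w f) (maxn N N1); last by move=> _; apply: Or32.
    have [?|ef|fe] := exp_total ltP e f; first exact: Or31.
      by move: Nf; rewrite -ef leqNgt eN.
    by apply: Or33; apply/VE.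
  apply: satS; apply: Sp_sub; first exact: idl_ideal.
  move=> f /= [ef|Nf|//]; apply: sub_idl; [left|right]; apply: Sp_mon => //=.
  exact: leq_trans (leq_maxr _ _) Nf.
by case=> u Qu Hu; exists u => //; rewrite /lead_ideal /colon /= -mulrA.
Qed.

End Weighted.

Lemma lead_ideal_union : is_ideal [set r | exists e, lead_ideal e r].
Proof.
split=> [|x y [e ex] [f fy]|b x [e ex]].
- by exists 0; exact: (ideal0 (lead_ideal_ideal 0)).
- exists (e + f); apply: (idealD (lead_ideal_ideal _)).
    by apply: lead_idealS ex => i; rewrite ffun_addE leq_addr.
  by apply: lead_idealS fy => i; rewrite ffun_addE leq_addl.
- by exists e; exact: (idealM (lead_ideal_ideal e)).
Qed.

Lemma lead_ideal_max : exists m, forall e, lead_ideal e `<=` lead_ideal m.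
Proof.
have [g gC] := noeth_gens noethR lead_ideal_union.
suff [m mP] : exists m, forall x, x \in g -> lead_ideal m x.
  exists m => e x ex; have : idl [set` g] x by rewrite -gC; exists e.
  exact: (idl_sub (lead_ideal_ideal m)).
have : forall x, x \in g -> exists e, lead_ideal e x.
  move=> x xg; have : [set r | exists e, lead_ideal e r] x by rewrite gC; exact: sub_idl.
  by [].
elim: g {gC} => [|x g IH] H; first by exists 0.
have [|m mP] := IH; first by move=> y yg; apply: H; rewrite inE yg orbT.
have [e ex] := H x (mem_head _ _).
exists (e + m) => y; rewrite inE => /orP[/eqP ->|/mP].
  by apply: lead_idealS ex => i; rewrite ffun_addE leq_addr.
by apply: lead_idealS => i; rewrite ffun_addE leq_addl.
Qed.

End Dependence.

(** * Part (b) *)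

Section DependenceAboveDimension.
Context (R : comPzRingType) (noethR : noetherian R) (s : nat).
Local Notation exps := {ffun 'I_s -> nat}.

Lemma minimal_parameters Q : is_prime_ideal Q ->
  (forall P : nat -> set R, ~ prime_chain s P) ->
  exists y : seq R, [/\ (size y < s)%N, [set` y] `<=` Q & locrad Q (idl [set` y])].
Proof.
move=> prQ nchain.
have [d [ds htd nhtd]] : exists d, [/\ (d < s)%N, htge d Q & ~ htge d.+1 Q].
  have : ~ htge s Q by move=> [P /nchain].
  elim: s => [|n IH] nht; first by case: nht; exact: htge0.
  have [htn|/IH[d [dn htd nhtd]]] := pselect (htge n Q); first by exists n.
  by exists d; split=> //; exact: ltnW.
have [y [szy yQ hty]] := parameters noethR prQ htd.
exists y; split=> //; first by rewrite szy.
have [Q' [prQ' yQ' Q'Q rQ']] := min_prime noethR (idl_ideal [set` y]) prQ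
  (idl_sub (prime_ideal prQ) yQ).
suff eqQ : Q' = Q by rewrite -eqQ.
rewrite eqEsubset; split=> //; apply: contrapT => nQQ'; apply: nhtd.
apply: (htgeS prQ (conj Q'Q nQQ')); apply: hty => //.
exact: subset_trans (@sub_idl _ _) yQ'.
Qed.

Lemma dependent_above_dim (a : 'I_s -> R) (lt : exps -> exps -> Prop) :
  (forall P : nat -> set R, ~ prime_chain s P) -> exp_order lt ->
  exists e, Sp a (lt e) (mon a e).
Proof.
move=> nchain ltP; apply: contrapT => indep.
pose C := [set r | exists e, lead_ideal a lt e r].
have idC : is_ideal C := lead_ideal_union a ltP.
have nC1 : ~ C 1.
  by move=> [e]; rewrite /lead_ideal /colon /= mul1r => He; apply: indep; exists e.
have [P0 [prP0 CP0]] : exists P, is_prime_ideal P /\ C `<=` P.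
  have [[|P l] [prl lC]] := prime_decomp noethR idC; first by case: nC1; exact: lC.
  by exists P; apply: prl; exact: mem_head.
have [Q [prQ CQ _ rQ]] := min_prime noethR idC prP0 CP0.
(* The polynomial a_i - x_i vanishes at [a], and 1 is the least monomial, so [a i] is a leading
   coefficient at the exponent 0. *)
have Qa i : Q (a i).
  apply: CQ; exists 0; rewrite /lead_ideal /colon /= mon0 mulr1.
  pose e : exps := [ffun j => nat_of_bool (j == i)].
  have -> : a i = mon a e.
    rewrite /mon (bigD1 i) //= big1 => [|j /negbTE ji]; rewrite ffunE ?ji ?expr0//.
    by rewrite eqxx mulr1 expr1.
  apply: Sp_mon; apply: exp_gt0 => //.
  by move=> /ffunP /(_ i); rewrite !ffunE eqxx.
have [y [szy yQ ry]] := minimal_parameters prQ nchain.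
have [w [w0 wP]] := lead_ideal_weight noethR a ltP.
have [m Cm] := lead_ideal_max noethR a ltP.
have [k yk] := locrad_exponent prQ idC rQ yQ.
pose Y n := [set` [seq x ^+ (k * n) | x <- y]].
(* Multiplied by a^(mn), a generator of [Y n] becomes the n-th power of z^k a^m, which at [Q] has
   weight at least [(wt w m).+1]. As [wt w e < n], this power has weight above that of e + mn, so
   [lead_ideal_mod_weight] would make 1 a leading coefficient at [Q]. *)
have strict n e : (wt w e < n)%N -> ~ sat Q (idl (Sp a (lt e) `|` Y n)) (mon a e).
  move=> en He; pose T := [set f | lt (e + m *+ n) f \/ ((wt w m).+1 * n <= wt w f)%N].
  have : sat Q (Sp a T) (1 * mon a (e + m *+ n)).
    rewrite mul1r monD -[sat _ _ _]/(colon (sat Q (Sp a T)) (mon a (m *+ n)) (mon a e)).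
    have idT : is_ideal (sat Q (Sp a T)) by apply: (sat_ideal prQ); exact: Sp_ideal.
    have idK := colon_ideal idT (mon a (m *+ n)).
    apply: (sat_sub _ _ He).
      by move=> x [u Qu Hx]; apply: (sat_sat prQ); exists u => //; rewrite mulrA.
    apply: (idl_sub idK) => x [Hx|/mapP[z zy ->]]; rewrite /colon /=.
      apply: (sub_sat prQ); apply: Sp_mulmon Hx => f ef; left; exact: exp_add.
    have [u Qu [e' /Cm /wP Hu]] := yk z zy.
    exists (u ^+ n); first exact: primeXN.
    rewrite monMn exprM -!exprMn.
    have {}Hu : Sp a [set f | ((wt w m).+1 <= wt w f)%N] (u * z ^+ k * mon a m).
      by apply: SpS Hu => f [].
    by have := Sp_wt_exp (n := n) Hu; rewrite mulrA; apply: SpS => f; right.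
  move=> /(lead_ideal_mod_weight noethR ltP prQ Qa w0 wP).
  have -> : (wt w (e + m *+ n)%R < (wt w m).+1 * n)%N by rewrite wtD wtMn mulSn ltn_add2r.
  move=> /(_ isT)[u Qu]; rewrite mulr1 => Hu; apply: Qu; apply: CQ.
  by exists (e + m *+ n).
have [L HL] := locrad_length noethR prQ (idl_ideal _) ry.
pose W := (\sum_i w i)%N.
(* Exponents in the box of side [M] have weight at most [M * W], whence the choice of [n] that makes
   [strict] available; [phi] then separates all of them. *)
have count M : (M ^ s <= (k * (M * W).+1) ^ size y * L + 1)%N.
  pose n := (M * W).+1.
  have : length_le Q (idl (set0 `|` [set` y])) L by rewrite set0U.
  move=> /(length_le_exps (k * n) prQ); rewrite set0U => -[phi Hphi].
  pose toexp (h : {ffun 'I_s -> 'I_M}) : exps := [ffun i => nat_of_ord (h i)].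
  have toexp_inj : injective toexp.
    move=> h h' /ffunP hh'; apply/ffunP => i; apply: val_inj.
    by have := hh' i; rewrite !ffunE.
  have wt_toexp h : (wt w (toexp h) < n)%N.
    rewrite /n ltnS /W big_distrr /wt; apply: leq_sum => i _ /=.
    by rewrite ffunE mulnC leq_mul2r ltnW ?orbT.
  pose A e := sat Q (idl (Sp a [set f | e = f \/ lt e f] `|` Y n)).
  have sA e : satid Q (A e).
    by split; [apply: (sat_ideal prQ); exact: idl_ideal|exact: sat_sat].
  have YA e : idl (Y n) `<=` A e.
    by apply: subset_trans (@sub_sat _ _ prQ _); apply: idl_subset => x; right.
  have AS e e' : lt e e' -> A e' `<=` A e.
    move=> ee'; apply: satS; apply: idl_sub; first exact: idl_ideal.
    move=> x [Hx|?]; apply: sub_idl; [left|by right].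
    apply: SpS Hx => f [<-|e'f]; right => //; exact: exp_trans e'f.
  have phi_lt h h' : lt (toexp h) (toexp h') ->
      (phi (A (toexp h')) < phi (A (toexp h)))%N.
    move=> hh'; have [_ _ H] := Hphi _ _ (sA (toexp h')) (sA (toexp h)) (YA _) (AS _ _ hh').
    rewrite ltnNge; apply/negP => /H AA.
    apply: (strict n (toexp h) (wt_toexp h)).
    have : A (toexp h') (mon a (toexp h)).
      apply: AA; apply: (sub_sat prQ); apply: sub_idl; left.
      by apply: Sp_mon; left.
    apply: satS; apply: idl_sub; first exact: idl_ideal.
    move=> x [Hx|?]; apply: sub_idl; [left|by right].
    by apply: SpS Hx => f [<- //|]; exact: exp_trans.
  have phi_le h : (phi (A (toexp h)) < (k * n) ^ size y * L + 1)%N.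
    by rewrite addn1 ltnS; case: (Hphi _ _ (sA (toexp h)) (sA (toexp h)) (YA _) (@subset_refl _ _)).
  have := @leq_card {ffun 'I_s -> 'I_M} 'I_((k * n) ^ size y * L + 1)
     (fun h => Ordinal (phi_le h)).
  rewrite card_ffun !card_ord; apply => h h' /(congr1 val) /= hh'.
  apply: toexp_inj; have [/phi_lt|//|/phi_lt] := exp_total ltP (toexp h) (toexp h');
  by rewrite hh' ltnn.
(* For positive [M], [(M * W).+1] is at most [W.+1 * M], so the bound in [count] is at most D M^t +
   1 with t = [size y] < [s]. The choice M = D + 2 makes M^(t+1) larger even when M^t = 1. *)
pose D := (((k * W.+1) ^ size y) * L)%N; pose M := D.+2.
have le_exp a1 a2 p : (a1 <= a2)%N -> (a1 ^ p <= a2 ^ p)%N.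
  by case: p => // p le12; rewrite leq_exp2r.
have leD : ((k * (M * W).+1) ^ size y * L <= D * M ^ size y)%N.
  rewrite /D mulnAC leq_mul2r -expnMn le_exp ?orbT//.
  by rewrite -mulnA leq_mul2l mulSn [(W * M)%N]mulnC -addn1 addnC leq_add2r orbT.
have ltM : (D * M ^ size y + 1 < M * M ^ size y)%N.
  have : (0 < M ^ size y)%N by rewrite expn_gt0.
  rewrite /M; move: (_ ^ _)%N => X X0; rewrite !mulSn; lia.
have leM : (M * M ^ size y <= M ^ s)%N by rewrite -expnS leq_exp2l.
by move: (count M) leD ltM leM; lia.
Qed.

End DependenceAboveDimension.

(** * Krull dimension, polynomials, and the theorem *)

Section KrullDimension.
Context (R : comPzRingType).

Let lengths : set (extended int) :=
  [set EFin n%:Z | n in [set n | exists P : nat -> set R, prime_chain n P]].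

Lemma chain_of_krull_dim s : (0 < s)%N -> (EFin s%:Z <= krull_dim R)%O ->
  exists P : nat -> set R, prime_chain s P.
Proof.
move=> s0 le_s; apply: contrapT => nchain.
have ub : ubound lengths (EFin s.-1%:Z).
  move=> _ [n [P cP] <-]; rewrite leEereal /= lez_nat -ltnS prednK // ltnNge.
  by apply/negP => sn; apply: nchain; exists P; exact: prime_chain_leq cP.
suff : (krull_dim R <= EFin s.-1%:Z)%O.
  move=> /(le_trans le_s); rewrite leEereal /= lez_nat.
  by rewrite -{1}(prednK s0) ltnn.
(* For the empty set, and for a missing supremum, the default is -oo, which is below any bound. *)
rewrite /krull_dim /supremum -/lengths; case: ifP => // _.
by case: xgetP => // y _ [_]; apply.
Qed.

(** A supremum exists, so the default is not returned: the lengths either have a maximum or are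
    unbounded, with supremum +oo. *)
Lemma prime_chain_krull_dim s (P : nat -> set R) :
  prime_chain s P -> (EFin s%:Z <= krull_dim R)%O.
Proof.
move=> cP; apply: ge_supremum_Nmem; last by exists s => //; exists P.
pose has_chain n := `[< exists P : nat -> set R, prime_chain n P >].
have [[N HN]|nN] := pselect (exists N, forall n, has_chain n -> (n <= N)%N).
  have exs : exists n, has_chain n by exists s; apply/asboolP; exists P.
  have [n /asboolP cn max_n] := ex_maxnP exs HN.
  exists (EFin n%:Z); split=> [_ [m cm <-]|y]; last by apply; exists n.
  by rewrite leEereal /= lez_nat max_n //; apply/asboolP.
exists (@EPInf int); split=> [_ [m _ <-]|[y||//] uby]; rewrite leEereal /= ?num_real//.
  case: nN; exists `|y|%N => n /asboolP cn.
  have : (EFin n%:Z <= EFin y)%O by apply: uby; exists n.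
  by rewrite leEereal /=; lia.
have : (EFin s%:Z <= @ENInf int)%O by apply: uby; exists s => //; exists P.
by rewrite leEereal.
Qed.

End KrullDimension.

Section Monomials.
Context (s : nat).
Local Notation exps := {ffun 'I_s -> nat}.
Implicit Types (e f : exps) (m : {cmonom nat}).

Definition to_monom e : {cmonom nat} :=
  [cmonom oapp e 0%N (insub i) | i in [fset i in iota 0 s]%fset]%M.

Definition of_monom m : exps := [ffun i => m (val i)].

Lemma to_monomE e i : to_monom e i = oapp e 0%N (insub i).
Proof.
rewrite cmE fsfun_fun in_fset /= mem_iota /=; case: ifP => // si.
by rewrite insubN // si.
Qed.

Lemma to_monomK : cancel to_monom of_monom.
Proof. by move=> e; apply/ffunP => i; rewrite ffunE to_monomE valK. Qed.

Lemma of_monomK m : (forall i, (s <= i)%N -> m i = 0%N) -> to_monom (of_monom m) = m.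
Proof.
move=> m0; apply/eqP/cmP => i; rewrite to_monomE.
by case: insubP => [j _ <-|] /=; [rewrite ffunE|rewrite -leqNgt => /m0].
Qed.

Lemma to_monomD e f : to_monom (e + f) = mmul (to_monom e) (to_monom f).
Proof.
apply/eqP/cmP => i; rewrite cmM !to_monomE.
by case: insubP => //= j _ _; rewrite ffun_addE.
Qed.

Lemma to_monom0 : to_monom 0 = mone.
Proof.
by apply/eqP/cmP => i; rewrite cm1 to_monomE; case: insubP => //= j _ _; rewrite ffunE.
Qed.

Lemma monomial_exp_order lt : monomial_order lt ->
  exp_order (fun e f => lt (to_monom e) (to_monom f)).
Proof.
case=> irr trans total gt1 mul; split.
- by move=> e; exact: irr.
- by move=> e f g; exact: trans.
- move=> e f; have [?|/(can_inj to_monomK) ?|?] := total (to_monom e) (to_monom f);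
  by [apply: Or31|apply: Or32|apply: Or33].
- by move=> e e0; rewrite to_monom0; apply: gt1; rewrite -to_monom0 => /(can_inj to_monomK).
- by move=> e f g; rewrite !to_monomD; exact: mul.
Qed.

Context (R : comPzRingType) (a : 'I_s -> R).
Implicit Types (p q : {malg R[{cmonom nat}]}).

Lemma eval_widen p (d : {fset {cmonom nat}}) : (msupp p `<=` d)%fset ->
  eval_first_vars a p = \sum_(m <- d) p@_m * mon a (of_monom m).
Proof.
move=> pd; rewrite -(big_fset_incl _ pd).
  by apply: eq_bigr => m _; congr (_ * _); apply: eq_bigr => i _; rewrite ffunE.
by move=> m _ /mcoeff_outdom ->; rewrite mul0r.
Qed.

Lemma evalD p q : eval_first_vars a (p + q) = eval_first_vars a p + eval_first_vars a q.
Proof.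
rewrite (eval_widen (msuppD_le p q)) (eval_widen (fsubsetUl _ (msupp q))).
rewrite (eval_widen (fsubsetUr (msupp p) _)) -big_split.
by apply: eq_bigr => m _; rewrite mcoeffD mulrDl.
Qed.

Lemma evalU c e : eval_first_vars a << c *g to_monom e >> = c * mon a e.
Proof.
by rewrite (eval_widen (msuppU_le)) big_seq_fset1 mcoeffUU to_monomK.
Qed.

Lemma eval0 : eval_first_vars a 0 = 0.
Proof. by rewrite /eval_first_vars msupp0 big_seq_fset0. Qed.

Lemma init_coefE lt p : init_coef lt p = p@_(init_monom lt p).
Proof. by rewrite /init_coef /init_term mcoeffUU. Qed.

Lemma dependent_exps lt : monomial_order lt -> (1 : R) <> 0 -> dependent lt a ->
  exists e, Sp a (fun f => lt (to_monom e) (to_monom f)) (mon a e).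
Proof.
move=> ltP R1 [p [p_s p0 [d]]]; rewrite init_coefE.
set m := init_monom lt p => pmd.
have mp : m \in msupp p.
  by rewrite -mcoeff_neq0; apply/eqP => pm0; apply: R1; rewrite -pmd pm0 mul0r.
(* If [xget] falls back on its default, the initial monomial is 1, which is below every other
   monomial anyway. *)
have min_m m' : m' \in msupp p -> m' <> m -> lt m m'.
  rewrite /m /init_monom; case: xgetP => [m1 _ [_ H] m'p m'm|_ m'p m'm]; first exact: H.
  exact: monomial_order_gt1.
have monK m' : m' \in msupp p -> to_monom (of_monom m') = m'.
  by move=> /p_s; exact: of_monomK.
exists (of_monom m).
have := eval_widen (fsubset_refl (msupp p)); rewrite p0 (big_fsetD1 m) //=.
move=> /esym/eqP; rewrite addr_eq0 => /eqP Hm.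
have -> : mon a (of_monom m) = d * (p@_m * mon a (of_monom m)).
  by rewrite mulrA [d * _]mulrC pmd mul1r.
rewrite Hm; apply: (idealM (Sp_ideal _ _)); apply: (idealN (Sp_ideal _ _)).
rewrite big_seq; apply: (ideal_sum (Sp_ideal _ _)) => m'.
rewrite !inE => /andP[/eqP m'm m'p].
apply: (idealM (Sp_ideal _ _)); apply: Sp_mon => /=.
by rewrite !monK //; exact: min_m.
Qed.

Lemma exps_dependent lt e : monomial_order lt ->
  Sp a (fun f => lt (to_monom e) (to_monom f)) (mon a e) -> dependent lt a.
Proof.
move=> ltP He.
(* In the zero ring the zero polynomial is a relation, its coefficient 0 being invertible. *)
have [R0|R1] := pselect ((1 : R) = 0).
  exists 0; split; [by move=> m; rewrite msupp0|exact: eval0|].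
  by exists 0; rewrite mulr0 R0.
have [F [Fe He']] : exists F : seq (R * exps),
    (forall c, c \in F -> lt (to_monom e) (to_monom c.2)) /\
    mon a e = \sum_(c <- F) c.1 * mon a c.2.
  pose D := [set x | exists F : seq (R * exps),
    (forall c, c \in F -> lt (to_monom e) (to_monom c.2)) /\
    x = \sum_(c <- F) c.1 * mon a c.2].
  suff idD : is_ideal D.
    apply: (Sp_sub idD _ He) => f ef; exists [:: (1, f)].
    by split=> [c|]; [rewrite inE => /eqP ->|rewrite big_seq1 mul1r].
  split=> [|x y [F [Fe ->]] [G [Ge ->]]|b x [F [Fe ->]]].
  - by exists [::]; rewrite big_nil.
  - exists (F ++ G); rewrite big_cat; split=> // c.
    by rewrite mem_cat => /orP[/Fe|/Ge].
  - exists [seq (b * c.1, c.2) | c <- F]; split=> [c /mapP[c' /Fe ? ->] //|].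
    by rewrite big_map mulr_sumr; apply: eq_bigr => c _; rewrite /= mulrA.
(* Terms of [F] may share an exponent or cancel, but all lie above [e], so the coefficient of x^e
   stays 1. *)
pose p := << 1 *g to_monom e >> + \sum_(c <- F) << - c.1 *g to_monom c.2 >>.
have p_out m : m != to_monom e -> (forall c, c \in F -> m <> to_monom c.2) -> p@_m = 0.
  move=> me mF; rewrite mcoeffD mcoeffU eq_sym (negbTE me) mulr0n add0r raddf_sum.
  rewrite big_seq big1 // => c /mF /eqP mc /=.
  by rewrite mcoeffU eq_sym (negbTE mc).
have pe : p@_(to_monom e) = 1.
  rewrite mcoeffD mcoeffUU raddf_sum big_seq big1 ?addr0 // => c cF /=.
  rewrite mcoeffU; case: eqP => // ce.
  by case: (monomial_order_irr ltP (m := to_monom e)); rewrite -{2}ce; exact: Fe.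
have p_supp m : m \in msupp p -> m = to_monom e \/ exists2 c, c \in F & m = to_monom c.2.
  rewrite -mcoeff_neq0 => /eqP pm; have [->|me] := eqVneq m (to_monom e); first by left.
  right; apply: contrapT => H; apply: pm; apply: p_out => // c cF mc.
  by apply: H; exists c.
have ep : to_monom e \in msupp p by rewrite -mcoeff_neq0 pe; apply/eqP.
have init_p : init_monom lt p = to_monom e.
  apply: xget_unique.
    by split=> // m /p_supp[//|[c /Fe ? ->]].
  move=> m [mp mmin]; apply: contrapT => me.
  have em := mmin _ ep (fun h => me (esym h)).
  case: (p_supp m mp) => [//|[c /Fe em' mc]].
  apply: (monomial_order_irr ltP (m := m)); apply: (monomial_order_trans ltP em).
  by rewrite mc.
exists p; split.
- have out f i : (s <= i)%N -> to_monom f i = 0%N.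
    by move=> si; rewrite to_monomE insubN // -leqNgt.
  by move=> m /p_supp[->|[c _ ->]] i; exact: out.
- rewrite evalD evalU mul1r He'.
  have -> : eval_first_vars a (\sum_(c <- F) << - c.1 *g to_monom c.2 >>) =
      \sum_(c <- F) - c.1 * mon a c.2.
    elim: F {Fe He' p p_out pe p_supp ep init_p} => [|c F IH].
      by rewrite !big_nil eval0.
    by rewrite !big_cons evalD evalU IH.
  by rewrite -big_split big1 // => c _ /=; rewrite mulNr addrN.
- by rewrite init_coefE init_p pe; exists 1; rewrite mulr1.
Qed.

End Monomials.

Theorem theorem2p7 (R : comPzRingType) (s : nat) :
  noetherian R -> (0 < s)%N ->
  ((EFin s%:Z <= krull_dim R)%O ->
     exists a : 'I_s -> R,
       forall lt : {cmonom nat} -> {cmonom nat} -> Prop,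
         monomial_order lt -> independent lt a) /\
  ((krull_dim R < EFin s%:Z)%O ->
     forall a : 'I_s -> R,
       forall lt : {cmonom nat} -> {cmonom nat} -> Prop,
         monomial_order lt -> dependent lt a).
Proof.
move=> noethR; case: s => // s s0; split=> [dim_ge|dim_lt a lt ltP].
  have [P cP] := chain_of_krull_dim s0 dim_ge.
  have prP : is_prime_ideal (P s.+1) by case: cP => + _; apply.
  have htP : htge s.+1 (P s.+1) by exists P.
  have [y [szy yP hty]] := parameters noethR prP htP.
  have [Q [prQ yQ QP rQ]] := min_prime noethR (idl_ideal [set` y]) prP
    (idl_sub (prime_ideal prP) yP).
  pose a (i : 'I_s.+1) := nth 0 y i.
  have aE : [set` y] = [set x | exists i, x = a i].
    rewrite eqEsubset; split=> [x /= xy|_ [i ->]].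
      have ys : (index x y < s.+1)%N by rewrite -szy index_mem.
      by exists (Ordinal ys); rewrite /a nth_index.
    by rewrite /= mem_nth // szy.
  have R1 : (1 : R) <> 0.
    by move=> R0; apply: (prime1 prQ); rewrite R0; exact: (ideal0 (prime_ideal prQ)).
  exists a => lt ltP /(dependent_exps ltP R1)[e].
  apply: (parameters_independent noethR prQ _ _ _ (monomial_exp_order s.+1 ltP)).
  - by move=> i; apply: yQ; apply: sub_idl; rewrite aE; exists i.
  - by rewrite -aE.
  - by apply: hty => //; exact: subset_trans (@sub_idl _ _) yQ.
have nchain (P : nat -> set R) : ~ prime_chain s.+1 P.
  move=> /prime_chain_krull_dim dim_ge.
  by have := lt_le_trans dim_lt dim_ge; rewrite ltxx.
have [e He] := dependent_above_dim noethR a nchain (monomial_exp_order s.+1 ltP).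
exact: exps_dependent He.
Qed.
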